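(* Let $m\geq 1$, $1\leq p<2$, and let $\omega$ be a continuous nondecreasing function on $[0,+\infty)$ with $\omega(0)=0$; let $\chi(\delta)=\delta\,\omega(\delta)$ and let $\chi^{-1}$ be the inverse function of $\chi$. Let $\varphi\in C^{1,\omega}(\mathbb T^m)$ be a real function such that the set $\nabla\varphi(\mathbb T^m)$ has positive Lebesgue measure. Then there is a constant $c=c(p,\varphi)>0$, independent of $\lambda$, such that $$\|e^{i\lambda\varphi}\|_{A_p(\mathbb T^m)}\geq c\Big(|\lambda|^{1/p}\chi^{-1}\Big(\frac{1}{|\lambda|}\Big)\Big)^m$$ for all $\lambda\in\Lambda(\varphi,p)$ with $|\lambda|\geq 1$.
   Context: $\mathbb T^m=\mathbb R^m/2\pi\mathbb Z^m$; functions on $\mathbb T^m$ are identified with functions on $\mathbb R^m$ that are $2\pi$-periodic in each variable. For integrable $f$ on $\mathbb T^m$, $\widehat f(k)=(2\pi)^{-m}\int_{\mathbb T^m}f(t)e^{-i(k,t)}dt$, $k\in\mathbb Z^m$. $A_1(\mathbb T^m)$ is the space of continuous $f$ on $\mathbb T^m$ with $\widehat f\in l^1(\mathbb Z^m)$; for $1<p\le 2$, $A_p(\mathbb T^m)$ is the space of integrable $f$ on $\mathbb T^m$ with $\widehat f\in l^p(\mathbb Z^m)$; $\|f\|_{A_p(\mathbb T^m)}=\big(\sum_{k\in\mathbb Z^m}|\widehat f(k)|^p\big)^{1/p}$. For a function $\varphi$ on $\mathbb T^m$, $\Lambda(\varphi,p)$ is the set of all $\lambda\in\mathbb R$ such that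 $e^{i\lambda\varphi}\in A_p(\mathbb T^m)$. For a domain $V\subseteq\mathbb R^m$ and a function $g$ on $V$, $\omega(V,g,\delta)=\sup\{|g(t_1)-g(t_2)|: t_1,t_2\in V, |t_1-t_2|\le\delta\}$; $g\in\mathrm{Lip}_\omega(V)$ means $\omega(V,g,\delta)=O(\omega(\delta))$ as $\delta\to+0$. $C^{1,\omega}(V)$ is the class of functions on $V$ all of whose first-order partial derivatives belong to $\mathrm{Lip}_\omega(V)$. $C^{1,\omega}(\mathbb T^m)$ is the class of functions $2\pi$-periodic in each variable belonging to $C^{1,\omega}(\mathbb R^m)$. *)

(* Defs.v *)
From HB Require Import structures.
From mathcomp Require Import all_boot all_order all_algebra.
From mathcomp Require Import all_classical all_reals all_analysis.
Set Implicit Arguments. Unset Strict Implicit. Unset Printing Implicit Defensive.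
Import Order.TTheory GRing.Theory Num.Theory.
Import numFieldNormedType.Exports.
Local Open Scope classical_set_scope.
Local Open Scope ring_scope.

Section Defs.
Variable R : realType.

Definition evec (m : nat) (j : 'I_m) : 'rV[R]_m := delta_mx 0 j.

Definition edist (m : nat) (x y : 'rV[R]_m) : R :=
  Num.sqrt (\sum_(i < m) (x 0 i - y 0 i) ^+ 2).

Definition Lip_omega (m : nat) (omega : R -> R) (g : 'rV[R]_m -> R) : Prop :=
  exists C : R, exists d0 : R, 0 < d0 /\
    forall d : R, 0 < d -> d <= d0 ->
      forall t1 t2 : 'rV[R]_m, edist t1 t2 <= d -> `|g t1 - g t2| <= C * omega d.

Definition C1omega (m : nat) (omega : R -> R) (phi : 'rV[R]_m -> R) : Prop :=
  forall j : 'I_m,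
    (forall x, derivable phi x (evec j)) /\
    Lip_omega omega (fun x => 'D_(evec j) phi x).

Definition periodic_Tm (m : nat) (phi : 'rV[R]_m -> R) : Prop :=
  forall (x : 'rV[R]_m) (j : 'I_m), phi (x + (2 * pi) *: evec j) = phi x.

Definition C1omega_T (m : nat) (omega : R -> R) (phi : 'rV[R]_m -> R) : Prop :=
  periodic_Tm phi /\ C1omega omega phi.

Definition grad (m : nat) (phi : 'rV[R]_m -> R) (x : 'rV[R]_m) : 'rV[R]_m :=
  \row_(j < m) 'D_(evec j) phi x.

Definition box (m : nat) (a b : 'rV[R]_m) : set 'rV[R]_m :=
  [set x | forall i, a 0 i <= x 0 i <= b 0 i].

Definition lebesgue_outer (m : nat) (A : set 'rV[R]_m) : \bar R :=
  ereal_inf [set esum [set: nat]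
                (fun n => (\prod_(i < m) ((ab.2 n) 0 i - (ab.1 n) 0 i))%:E)
            | ab in [set ab : (nat -> 'rV[R]_m) * (nat -> 'rV[R]_m) |
                     (forall n i, (ab.1 n) 0 i <= (ab.2 n) 0 i) /\
                     A `<=` \bigcup_n box (ab.1 n) (ab.2 n)]].

Definition rcons0 (n : nat) (s : R) (y : 'rV[R]_n) : 'rV[R]_n.+1 :=
  \row_(i < n.+1) (if unlift ord0 i is Some j then y 0 j else s).

Fixpoint int_Tm (n : nat) : ('rV[R]_n -> R) -> R :=
  match n with
  | 0 => fun f => f 0
  | n'.+1 => fun f =>
      Rintegral (@lebesgue_measure R) `[0, 2 * pi]%classic
        (fun s => int_Tm (fun y => f (rcons0 s y)))
  end.

Definition dotZ (m : nat) (k : 'rV[int]_m) (t : 'rV[R]_m) : R :=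
  \sum_(i < m) (k 0 i)%:~R * t 0 i.

(* Fourier coefficient of the complex function f = fre + i fim:
   (2pi)^-m int f(t) e^{-i(k,t)} dt, real and imaginary parts *)
Definition fourier_re (m : nat) (fre fim : 'rV[R]_m -> R) (k : 'rV[int]_m) : R :=
  (2 * pi) ^- m *
  int_Tm (fun t => fre t * cos (dotZ k t) + fim t * sin (dotZ k t)).
Definition fourier_im (m : nat) (fre fim : 'rV[R]_m -> R) (k : 'rV[int]_m) : R :=
  (2 * pi) ^- m *
  int_Tm (fun t => fim t * cos (dotZ k t) - fre t * sin (dotZ k t)).
Definition fourier_abs (m : nat) (fre fim : 'rV[R]_m -> R) (k : 'rV[int]_m) : R :=
  Num.sqrt (fourier_re fre fim k ^+ 2 + fourier_im fre fim k ^+ 2).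

Definition Ap_sum (m : nat) (p : R) (fre fim : 'rV[R]_m -> R) : \bar R :=
  esum [set: 'rV[int]_m] (fun k => (fourier_abs fre fim k `^ p)%:E).

Definition in_Ap (m : nat) (p : R) (fre fim : 'rV[R]_m -> R) : Prop :=
  (p = 1 -> continuous fre /\ continuous fim) /\ (Ap_sum p fre fim < +oo)%E.

Definition Ap_norm (m : nat) (p : R) (fre fim : 'rV[R]_m -> R) : R :=
  fine (Ap_sum p fre fim) `^ p^-1.

Definition expi_re (m : nat) (lam : R) (phi : 'rV[R]_m -> R) : 'rV[R]_m -> R :=
  fun t => cos (lam * phi t).
Definition expi_im (m : nat) (lam : R) (phi : 'rV[R]_m -> R) : 'rV[R]_m -> R :=
  fun t => sin (lam * phi t).

Definition Lambda (m : nat) (phi : 'rV[R]_m -> R) (p : R) : set R :=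
  [set lam | in_Ap p (expi_re lam phi) (expi_im lam phi)].

End Defs.

(* Main.v *)
(** Write [c_k] for the Fourier coefficients of [e^{i lam phi}], fix a point [t]
    and put [delta = chi^-1(1/|lam|)].  On a cube of side comparable to [delta]
    around [t], the phase [lam phi] differs from its linear part, of frequency
    [lam grad phi(t)], by at most a small constant.  Testing against a positive
    trigonometric kernel of degree [N ~ 1/delta] concentrated on that cube shows
    that [sum |c_k| >= 1/4] over the [k] within distance [O(N)] of
    [lam grad phi(t)], hence [sum |c_k|^p >= const * N^(-m(p-1))] over the same
    [k].  Cut the frequency space into cubes of side [N].  The cubes that meet
    [lam grad phi(T^m)] have total volume at least [|lam|^m] times the measure of
    [grad phi(T^m)], so there are at least [const * (|lam|/N)^m] of them, and each
    [k] is counted for at most [3^m] cubes.  Adding up gives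
    [sum |c_k|^p >= const * |lam|^m N^(-mp)]. *)

Require Import Defs.
From HB Require Import structures.
From mathcomp Require Import all_boot all_order all_algebra.
From mathcomp Require Import all_classical all_reals all_analysis.
From mathcomp Require Import ring lra zify.
Import Order.TTheory GRing.Theory Num.Theory.
Import numFieldNormedType.Exports.
Local Open Scope classical_set_scope.
Local Open Scope ring_scope.

(** * Iterated integrals of bounded Lipschitz functions *)

Section TorusIntegral.
Variable R : realType.
Implicit Types (M : R).

(* This class is stable under products and under integrating out variables, which
   makes the iterated integral [int_Tm] linear and monotone on it. *)
Definition bounded_lipschitz (n : nat) (M : R) (f : 'rV[R]_n -> R) : Prop :=
  (forall x, `|f x| <= M) /\
  (forall x y, `|f x - f y| <= M * \sum_(i < n) `|x 0 i - y 0 i|).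

Definition blip (n : nat) (f : 'rV[R]_n -> R) : Prop :=
  exists M, bounded_lipschitz n M f.

Lemma rcons0_ord0 n (s : R) (y : 'rV[R]_n) : rcons0 s y 0 ord0 = s.
Proof. by rewrite mxE unlift_none. Qed.

Lemma rcons0_lift n (s : R) (y : 'rV[R]_n) (j : 'I_n) :
  rcons0 s y 0 (lift ord0 j) = y 0 j.
Proof. by rewrite mxE liftK. Qed.

Lemma bounded_lipschitz_ge0 n M f : bounded_lipschitz n M f -> 0 <= M.
Proof. by move=> [/(_ 0) h _]; exact: le_trans h. Qed.

Lemma blip_cst n (c : R) : blip n (fun _ => c).
Proof.
exists `|c|; split=> // x y; rewrite subrr normr0 mulr_ge0// sumr_ge0//.
Qed.

Lemma blipD n f g : blip n f -> blip n g -> blip n (fun x => f x + g x).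
Proof.
move=> [M [fb fl]] [N [gb gl]]; exists (M + N); split=> [x|x y].
  by rewrite (le_trans (ler_normD _ _))// lerD.
rewrite opprD addrACA mulrDl (le_trans (ler_normD _ _))//.
by rewrite lerD.
Qed.

Lemma blipM n f g : blip n f -> blip n g -> blip n (fun x => f x * g x).
Proof.
move=> [M Mf] [N Ng]; have M0 := bounded_lipschitz_ge0 _ _ _ Mf.
have N0 := bounded_lipschitz_ge0 _ _ _ Ng.
case: Mf Ng => [fb fl] [gb gl].
have MN0 : 0 <= M * N by exact: mulr_ge0.
exists (2 * (M * N)); split=> [x|x y].
  rewrite normrM (@le_trans _ _ (M * N))//; first exact: ler_pM.
  lra.
have -> : f x * g x - f y * g y = (f x - f y) * g x + f y * (g x - g y) by ring.
rewrite (le_trans (ler_normD _ _))// !normrM.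
have -> : forall S, 2 * (M * N) * S = (M * S) * N + M * (N * S) by move=> S; ring.
by apply: lerD; apply: ler_pM.
Qed.

Lemma blipZ n c f : blip n f -> blip n (fun x => c * f x).
Proof. exact/blipM/blip_cst. Qed.

Lemma blipN n f : blip n f -> blip n (fun x => - f x).
Proof.
move=> /(blipZ _ (-1)); congr (blip _ _); apply/funext => x.
by rewrite mulN1r.
Qed.

Lemma blip_sum n (I : Type) (r : seq I) (F : I -> 'rV[R]_n -> R) :
  (forall i, blip n (F i)) -> blip n (fun x => \sum_(i <- r) F i x).
Proof.
move=> HF; elim: r => [|i r IH].
  under eq_fun do rewrite big_nil; exact: blip_cst.
under eq_fun do rewrite big_cons; exact: blipD.
Qed.

Lemma bounded_lipschitz_section n M f (s : R) :
  bounded_lipschitz n.+1 M f -> bounded_lipschitz n M (fun y => f (rcons0 s y)).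
Proof.
move=> [fb fl]; split=> // x y; rewrite (le_trans (fl _ _))//.
rewrite big_ord_recl !rcons0_ord0 subrr normr0 add0r.
by under eq_bigr do rewrite !rcons0_lift.
Qed.

Lemma blip_section n f (s : R) :
  blip n.+1 f -> blip n (fun y => f (rcons0 s y)).
Proof. by move=> [M Mf]; exists M; exact: bounded_lipschitz_section. Qed.

Lemma lipschitz1_continuous (g : R -> R) M :
  (forall s t, `|g s - g t| <= M * `|s - t|) -> continuous g.
Proof.
move=> gl s; apply/cvgrPdist_le => e e0.
have K0 : 0 < `|M| + 1 by rewrite ltr_wpDl.
near=> t; rewrite (le_trans (gl _ _))//.
have st : `|s - t| <= e / (`|M| + 1).
  by near: t; apply: cvgr_dist_le => //; exact: divr_gt0.
rewrite (@le_trans _ _ ((`|M| + 1) * `|s - t|))//.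
  by rewrite ler_wpM2r// (le_trans (ler_norm _))// lerDl.
by rewrite -ler_pdivlMl// mulrC.
Unshelve. all: by end_near. Qed.

Let I0 : set R := `[0, 2 * pi]%classic.

Lemma continuous_integrable_2pi (g : R -> R) : continuous g ->
  (@lebesgue_measure R).-integrable `[0, 2 * pi]%classic (EFin \o g).
Proof.
move=> gc; apply: continuous_compact_integrable; first exact: segment_compact.
exact: continuous_subspaceT.
Qed.

(** The four properties are proved together by induction on [n]: integrating over the outer variable
    requires the inner integral to be continuous in it, and this continuity follows from linearity,
    monotonicity and the value on constants in dimension [n]. *)
Lemma int_Tm_linear n :
  [/\ forall f g, blip n f -> blip n g ->
        int_Tm (fun x => f x + g x) = int_Tm f + int_Tm g,
      forall c f, blip n f -> int_Tm (fun x => c * f x) = c * int_Tm f,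
      forall f g, blip n f -> blip n g -> (forall x, f x <= g x) ->
        int_Tm f <= int_Tm g &
      forall c, int_Tm (fun _ : 'rV[R]_n => c) = (2 * pi) ^+ n * c].
Proof.
have pi20 : 0 <= 2 * pi :> R by rewrite mulr_ge0// pi_ge0.
elim: n => [|n [IHD IHZ IHle IHc]].
  by split=> //= c; rewrite expr0 mul1r.
have IHB f g : blip n f -> blip n g ->
    int_Tm (fun x => f x - g x) = int_Tm f - int_Tm g.
  move=> Hf Hg; rewrite (IHD f (fun x => - g x))//; last exact: blipN.
  congr (_ + _); rewrite -mulN1r -IHZ//.
  by congr int_Tm; apply/funext => x; rewrite mulN1r.
have cont f : blip n.+1 f ->
      continuous (fun s : R => int_Tm (fun y => f (rcons0 s y))).
  move=> Hf; have [M Mf] := Hf.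
  (* Two slices of [f] differ pointwise by at most [M * |s - t|], and the remaining variables range
     over a cube of volume [(2 * pi) ^+ n]. *)
  apply: (@lipschitz1_continuous _ ((2 * pi) ^+ n * M)) => s t.
  have Hst : forall y, `|f (rcons0 s y) - f (rcons0 t y)| <= M * `|s - t|.
    move=> y; rewrite (le_trans (Mf.2 _ _))//.
    rewrite big_ord_recl !rcons0_ord0 big1 ?addr0// => i _.
    by rewrite !rcons0_lift subrr normr0.
  rewrite -IHB; [|exact: blip_section..].
  have B : blip n (fun x => f (rcons0 s x) - f (rcons0 t x)).
    by apply: blipD; [|apply: blipN]; exact: blip_section.
  rewrite -mulrA -IHc ler_norml; apply/andP; split.
    rewrite -mulN1r -IHZ; last exact: blip_cst.
    apply: IHle => //; first by apply: blipZ; exact: blip_cst.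
    by move=> y; move: (Hst y); rewrite ler_norml mulN1r => /andP[].
  apply: IHle => //; first exact: blip_cst.
  by move=> y; move: (Hst y); rewrite ler_norml => /andP[].
have mI : measurable I0 by exact: measurable_itv.
split=> /=.
- move=> f g Hf Hg.
  have -> : (fun s => int_Tm (fun y => f (rcons0 s y) + g (rcons0 s y))) =
      (fun s => int_Tm (fun y => f (rcons0 s y)) + int_Tm (fun y => g (rcons0 s y))).
    by apply/funext => s; apply: (IHD (fun y => f (rcons0 s y))
      (fun y => g (rcons0 s y))); exact: blip_section.
  by rewrite RintegralD//; apply: continuous_integrable_2pi; exact: cont.
- move=> c f Hf.
  have -> : (fun s => int_Tm (fun y => c * f (rcons0 s y))) =
      (fun s => c * int_Tm (fun y => f (rcons0 s y))).
    by apply/funext => s; apply: (IHZ c (fun y => f (rcons0 s y))); exact: blip_section.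
  by rewrite RintegralZl//; apply: continuous_integrable_2pi; exact: cont.
- move=> f g Hf Hg fg; apply: le_Rintegral => //.
  + by apply: continuous_integrable_2pi; exact: cont.
  + by apply: continuous_integrable_2pi; exact: cont.
  + by move=> s _; apply: IHle => //; exact: blip_section.
- move=> c; transitivity
    (Rintegral (@lebesgue_measure R) I0 (fun=> (2 * pi) ^+ n * c)).
    by apply: eq_Rintegral => s _; exact: IHc.
  rewrite Rintegral_cst// [X in fine X](lebesgue_measure_itv `[0, 2 * pi]%R)/= lte_fin.
  rewrite exprS; case: ltP => h.
    by rewrite -EFinB/= subr0; ring.
  have -> : 2 * pi = 0 :> R by apply/le_anti; rewrite h pi20.
  by rewrite mulr0 !mul0r.
Qed.

Section Corollaries.
Variable n : nat.
Implicit Types f g : 'rV[R]_n -> R.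

Lemma int_TmD f g : blip n f -> blip n g ->
  int_Tm (fun x => f x + g x) = int_Tm f + int_Tm g.
Proof. by have [h _ _ _] := int_Tm_linear n; exact: h. Qed.

Lemma int_TmZ c f : blip n f -> int_Tm (fun x => c * f x) = c * int_Tm f.
Proof. by have [_ h _ _] := int_Tm_linear n; exact: h. Qed.

Lemma le_int_Tm f g : blip n f -> blip n g -> (forall x, f x <= g x) ->
  int_Tm f <= int_Tm g.
Proof. by have [_ _ h _] := int_Tm_linear n; exact: h. Qed.

Lemma int_Tm_cst c : int_Tm (fun _ : 'rV[R]_n => c) = (2 * pi) ^+ n * c.
Proof. by have [_ _ _ h] := int_Tm_linear n; exact: h. Qed.

Lemma int_Tm_sum (I : Type) (r : seq I) (F : I -> 'rV[R]_n -> R) :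
  (forall i, blip n (F i)) ->
  int_Tm (fun x => \sum_(i <- r) F i x) = \sum_(i <- r) int_Tm (F i).
Proof.
move=> HF; elim: r => [|i r IH].
  rewrite big_nil -[RHS](mulr0 ((2 * pi) ^+ n)) -int_Tm_cst.
  by congr int_Tm; apply/funext => x; rewrite big_nil.
rewrite big_cons -IH -int_TmD//; last exact: blip_sum.
by congr int_Tm; apply/funext => x; rewrite big_cons.
Qed.

End Corollaries.

End TorusIntegral.

(** * Trigonometric functions *)

Section Trigonometry.
Variable R : realType.
Implicit Types (x a : R) (l : int).

Lemma cosD2piz x l : cos (x + 2 * pi * l%:~R) = cos x.
Proof.
have H n (y : R) : cos (y + 2 * pi * n%:R) = cos y.
  rewrite (mulr_natl pi 2) mulr_natr. by rewrite (periodicn (@cosD2pi R)).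
case: l => n; first exact: H.
rewrite NegzE mulrNz mulrN.
by rewrite -[X in _ = cos X](subrK (2 * pi * n.+1%:R) x) H.
Qed.

Lemma sinD2piz x l : sin (x + 2 * pi * l%:~R) = sin x.
Proof. by rewrite -!cosBpihalf addrAC cosD2piz. Qed.

Lemma is_derive_sin_affine (a b s : R) : b != 0 ->
  is_derive s 1 (fun s : R => b^-1 * sin (a + b * s)) (cos (a + b * s)).
Proof.
move=> b0.
have d1 : is_derive s 1 (fun s : R => a + b * s) b.
  by apply: is_derive_eq; rewrite add0r mul1r; exact: mulr1.
have d2 : is_derive s 1 (sin \o (fun s : R => a + b * s)) (cos (a + b * s) * b).
  exact: (@is_derive1_comp _ sin (fun s : R => a + b * s) s).
have : is_derive s 1 (b^-1 *: (sin \o (fun s : R => a + b * s)))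
    (b^-1 *: (cos (a + b * s) * b)).
  exact: is_deriveZ.
by rewrite /GRing.scale/= mulrCA mulVf// mulr1.
Qed.

Lemma Rintegral_cos_2pi a l :
  Rintegral (@lebesgue_measure R) `[0, 2 * pi]%classic
    (fun s => cos (a + l%:~R * s)) = 2 * pi * ((l == 0)%:R * cos a).
Proof.
have pi20 : 0 < 2 * pi :> R by rewrite mulr_gt0// pi_gt0.
have [->|l0] := eqVneq l 0.
  transitivity (Rintegral (@lebesgue_measure R) `[0, 2 * pi]%classic (fun=> cos a)).
    by apply: eq_Rintegral => s _; rewrite mulr0z mul0r addr0.
  rewrite Rintegral_cst//= [X in fine X](lebesgue_measure_itv `[0, 2 * pi]%R)/=.
  by rewrite lte_fin pi20/=; ring.
have l0' : l%:~R != 0 :> R by rewrite intr_eq0.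
have dF s := @is_derive_sin_affine a l%:~R s l0'.
have cF : continuous (fun s : R => l%:~R^-1 * sin (a + l%:~R * s)).
  by move=> s; apply/differentiable_continuous/derivable1_diffP.
rewrite /Rintegral.
rewrite (@continuous_FTC2 _ _ (fun s => l%:~R^-1 * sin (a + l%:~R * s)))//.
- rewrite mulr0 addr0 (mulrC l%:~R) sinD2piz subee//=; ring.
- apply: continuous_subspaceT => s; apply: continuous_comp; last exact: continuous_cos.
  apply: cvgD; first exact: cvg_cst.
  by apply: cvgM; [exact: cvg_cst|exact: cvg_id].
- split.
  + by move=> s _; have [] := dF s.
  + by apply: cvg_at_right_filter; exact: cF.
  + by apply: cvg_at_left_filter; exact: cF.
- by move=> s _; rewrite derive1E; have [_ ->] := dF s.
Qed.

Lemma cos_lipschitz x a : `|cos x - cos a| <= `|x - a|.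
Proof.
wlog ax : x a / a <= x => [hw|].
  have [/hw//|/ltW xa] := leP a x.
  by rewrite distrC (distrC x); exact: hw.
have dc (s : R) : s \in `]a, x[ -> is_derive s 1 (@cos R) (- sin s).
  by move=> _; exact: is_derive_cos.
have [|c _ ->] := MVT_segment ax dc.
  by apply: continuous_subspaceT; exact: continuous_cos.
by rewrite normrM normrN ler_piMl// sin_max.
Qed.

Lemma sin_lipschitz x a : `|sin x - sin a| <= `|x - a|.
Proof.
rewrite -!cosBpihalf (le_trans (cos_lipschitz _ _))//.
by rewrite opprB addrA subrK.
Qed.

Lemma cos_ge_quadratic x : 1 - x ^+ 2 / 2 <= cos x.
Proof.
have -> : cos x = 1 - sin (x / 2) ^+ 2 * 2.
  rewrite {1}(splitr x) -mulr2n cos_mulr2n cos2sin2 mulr2n; ring.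
have : sin (x / 2) ^+ 2 <= (x / 2) ^+ 2.
  have := sin_lipschitz (x / 2) 0; rewrite sin0 !subr0 => h.
  rewrite -(real_normK (num_real (sin _))) -(real_normK (num_real (x / 2))).
  by rewrite lerXn2r// nnegrE.
rewrite exprMn; lra.
Qed.

(** The half-angle formula reduces this to a lower bound on [sin (x / 2)], which the mean value
    theorem gives because the cosine is at least 1/2 on [[0, 1/2]]. *)
Lemma one_sub_cos_ge x : 0 <= x -> x <= 1 -> x ^+ 2 / 8 <= 1 - cos x.
Proof.
move=> x0 x1.
have -> : cos x = 1 - sin (x / 2) ^+ 2 * 2.
  rewrite {1}(splitr x) -mulr2n cos_mulr2n cos2sin2 mulr2n; ring.
suff : (x / 4) ^+ 2 <= sin (x / 2) ^+ 2 by rewrite exprMn; lra.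
have x20 : 0 <= x / 2 by rewrite divr_ge0.
have ds (s : R) : s \in `]0, (x / 2)[ -> is_derive s 1 (@sin R) (cos s).
  by move=> _; exact: is_derive_sin.
have cs : {within `[0, x / 2], continuous (@sin R)}.
  by apply: continuous_subspaceT; exact: continuous_sin.
have [c] := MVT_segment x20 ds cs.
rewrite in_itv/= => /andP[c0 cx]; rewrite sin0 !subr0 => ->.
have hc := cos_ge_quadratic c.
have c1 : c ^+ 2 <= 1 by rewrite expr_le1//; lra.
rewrite lerXn2r// ?nnegrE; [lra| |]; first by apply: mulr_ge0; lra.
suff : 0 <= (cos c - 2^-1) * (x / 2) by lra.
by apply: mulr_ge0; lra.
Qed.

End Trigonometry.

(** * Orthogonality of the exponentials for the iterated integral *)

Section CosIntegral.
Variable R : realType.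

(** Boundedness is dropped so that unbounded phases such as [dotZ k] qualify; composing with a sine
    or cosine gives back a [blip] function. *)
Definition l1_lipschitz n (g : 'rV[R]_n -> R) : Prop :=
  exists L, forall x y, `|g x - g y| <= L * \sum_(i < n) `|x 0 i - y 0 i|.

Lemma l1_lipschitzD n f g : l1_lipschitz n f -> l1_lipschitz n g ->
  l1_lipschitz n (fun x => f x + g x).
Proof.
move=> [L hL] [K hK]; exists (L + K) => x y.
by rewrite opprD addrACA mulrDl (le_trans (ler_normD _ _))// lerD.
Qed.

Lemma l1_lipschitzZ n c f : l1_lipschitz n f -> l1_lipschitz n (fun x => c * f x).
Proof.
move=> [L hL]; exists (`|c| * L) => x y.
by rewrite -mulrBr normrM -mulrA ler_wpM2l.
Qed.

Lemma l1_lipschitz_cst n c : l1_lipschitz n (fun=> c).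
Proof. by exists 0 => x y; rewrite subrr normr0 mul0r. Qed.

Lemma l1_lipschitz_dotZ n (l : 'rV[int]_n) : l1_lipschitz n (dotZ l).
Proof.
exists (\sum_(i < n) `|(l 0 i)%:~R|) => x y.
rewrite /dotZ -sumrB (le_trans (ler_norm_sum _ _ _))// mulr_suml.
apply: ler_sum => i _; rewrite -mulrBr normrM ler_wpM2l//.
by rewrite (bigD1 i)//= lerDl sumr_ge0.
Qed.

Lemma blip_cos n g : l1_lipschitz n g -> blip R n (fun x => cos (g x)).
Proof.
move=> [L hL]; exists (`|L| + 1); split=> [x|x y].
  by rewrite (le_trans (cos_max _))// lerDr.
rewrite (le_trans (cos_lipschitz _ _ _))// (le_trans (hL _ _))//.
rewrite ler_wpM2r ?sumr_ge0// (le_trans (ler_norm _))//.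
by rewrite lerDl.
Qed.

Lemma blip_sin n g : l1_lipschitz n g -> blip R n (fun x => sin (g x)).
Proof.
move=> hg; under eq_fun do rewrite -cosBpihalf.
by apply: blip_cos; apply: l1_lipschitzD => //; exact: l1_lipschitz_cst.
Qed.

(** The free phase [a] makes the induction on the dimension work: fixing the first coordinate [s]
    adds [l 0 ord0 * s] to it. *)
Lemma int_Tm_cos n (l : 'rV[int]_n) (a : R) :
  int_Tm (fun x => cos (a + dotZ l x)) = (2 * pi) ^+ n * ((l == 0)%:R * cos a).
Proof.
elim: n l a => [|n IH] l a.
  rewrite /= /dotZ big_ord0 addr0 expr0 mul1r.
  by rewrite (_ : l == 0)// ?mul1r//; apply/eqP/rowP; case.
pose l' : 'rV[int]_n := \row_j l 0 (lift ord0 j).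
have dotE s y : dotZ l (rcons0 s y) = (l 0 ord0)%:~R * s + dotZ l' y :> R.
  rewrite /dotZ big_ord_recl rcons0_ord0; congr (_ + _).
  by apply: eq_bigr => i _; rewrite rcons0_lift mxE.
have l0E : (l == 0) = (l' == 0) && (l 0 ord0 == 0).
  apply/eqP/andP => [l0|[/eqP h1 /eqP h2]].
    by split; [apply/eqP/rowP => j; rewrite !mxE|]; rewrite l0 mxE.
  apply/rowP => i; rewrite mxE; case: (unliftP ord0 i) => [j ->|->//].
  by move/rowP : h1 => /(_ j); rewrite !mxE.
transitivity (Rintegral (@lebesgue_measure R) `[0, 2 * pi]%classic
    (fun s => (2 * pi) ^+ n * (l' == 0)%:R * cos (a + (l 0 ord0)%:~R * s))).
  apply: eq_Rintegral => s _; rewrite -mulrA -IH; congr int_Tm.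
  by apply/funext => y; rewrite dotE addrA.
rewrite RintegralZl//; last first.
  apply: continuous_integrable_2pi => s; apply: continuous_comp; last exact: continuous_cos.
  apply: cvgD; first exact: cvg_cst.
  by apply: cvgM; [exact: cvg_cst|exact: cvg_id].
by rewrite Rintegral_cos_2pi l0E exprS; case: (l' == 0); case: (_ == 0); rewrite /=; ring.
Qed.

End CosIntegral.

(** * The Fejer-Korovkin kernel *)

Section DotZ.
Variables (R : realType) (n : nat).
Implicit Types (k l : 'rV[int]_n) (x y : 'rV[R]_n).

Lemma dotZDl k l x : dotZ (k + l) x = dotZ k x + dotZ l x.
Proof.
by rewrite /dotZ -big_split; apply: eq_bigr => i _; rewrite mxE intrD mulrDl.
Qed.

Lemma dotZNl k x : dotZ (- k) x = - dotZ k x.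
Proof.
by rewrite /dotZ -sumrN; apply: eq_bigr => i _; rewrite mxE mulrNz mulNr.
Qed.

Lemma dotZBl k l x : dotZ (k - l) x = dotZ k x - dotZ l x.
Proof. by rewrite dotZDl dotZNl. Qed.

Lemma dotZBr k x y : dotZ k (x - y) = dotZ k x - dotZ k y.
Proof.
by rewrite /dotZ -sumrB; apply: eq_bigr => i _; rewrite !mxE mulrBr.
Qed.

Lemma dotZ0l x : dotZ 0 x = 0.
Proof. by rewrite /dotZ big1// => i _; rewrite mxE mul0r. Qed.

Lemma dotZ_delta (i : 'I_n) x : dotZ (delta_mx 0 i) x = x 0 i.
Proof.
rewrite /dotZ (bigD1 i)//= mxE !eqxx mul1r big1 ?addr0// => j ji.
by rewrite mxE (negbTE ji) andbF mul0r.
Qed.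

End DotZ.

(** * Fourier coefficients as bounds for integrals of phases *)

Section FourierBound.
Variables (R : realType) (n : nat) (phi : 'rV[R]_n -> R) (lam : R).
Hypothesis phi_lip : l1_lipschitz R n phi.

Let gam k := fourier_abs (expi_re lam phi) (expi_im lam phi) k.

Let lipA k : l1_lipschitz R n (fun x => lam * phi x + - 1 * dotZ k x).
Proof.
apply: l1_lipschitzD; first exact: l1_lipschitzZ.
by apply: l1_lipschitzZ; exact: l1_lipschitz_dotZ.
Qed.

(** The integral is [(2 pi)^n] times the real part of [e^{-ib} c_k], and this real part is at most
    [|c_k|] in absolute value. *)
Lemma int_Tm_cos_phase k b :
  `|int_Tm (fun x => cos (lam * phi x - dotZ k x - b))| <= (2 * pi) ^+ n * gam k.
Proof.
have pi20 : 0 < (2 * pi) ^+ n :> R by rewrite exprn_gt0// mulr_gt0// pi_gt0.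
set fre := fourier_re (expi_re lam phi) (expi_im lam phi) k.
set fim := fourier_im (expi_re lam phi) (expi_im lam phi) k.
have freE : int_Tm (fun x => cos (lam * phi x + - 1 * dotZ k x)) = (2 * pi) ^+ n * fre.
  rewrite /fre /fourier_re mulVKf ?gt_eqF//; congr int_Tm; apply/funext => x.
  by rewrite mulN1r cosB.
have fimE : int_Tm (fun x => sin (lam * phi x + - 1 * dotZ k x)) = (2 * pi) ^+ n * fim.
  rewrite /fim /fourier_im mulVKf ?gt_eqF//; congr int_Tm; apply/funext => x.
  by rewrite mulN1r sinB.
have -> : int_Tm (fun x => cos (lam * phi x - dotZ k x - b)) =
    (2 * pi) ^+ n * (cos b * fre + sin b * fim).
  rewrite mulrDr mulrCA -freE mulrCA -fimE.
  rewrite -!int_TmZ; [|exact: blip_sin|exact: blip_cos].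
  rewrite -int_TmD; [|by apply: blipZ; exact: blip_cos|by apply: blipZ; exact: blip_sin].
  by congr int_Tm; apply/funext => x; rewrite cosB mulN1r; ring.
rewrite normrM (gtr0_norm pi20) ler_pM2l//.
rewrite -sqrtr_sqr /gam /fourier_abs ler_wsqrtr//.
have : 0 <= (sin b * fre - cos b * fim) ^+ 2 by exact: sqr_ge0.
have := cos2Dsin2 b; rewrite -/fre -/fim => cs.
have -> : fre ^+ 2 + fim ^+ 2 = (cos b ^+ 2 + sin b ^+ 2) * (fre ^+ 2 + fim ^+ 2).
  by rewrite cs mul1r.
lra.
Qed.

End FourierBound.

Section Kernel.
Variables (R : realType) (m N : nat) (t : 'rV[R]_m).
Local Notation I := 'rV['I_N.+1]_m.

Definition intv (J : I) : 'rV[int]_m := \row_i (J 0 i : nat)%:Z.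

Definition kangle : R := pi / N.+2%:R.

(* As a function of [l 0 i] the weight vanishes at [-1] and at [N + 1], and by
   [kweightDB] it is an eigenvector of the discrete Laplacian on {0, ..., N}: hence
   the first Fourier coefficient of the kernel is exactly [cos kangle]. *)
Definition kweight (l : 'rV[int]_m) : R :=
  \prod_(i < m) sin ((l 0 i + 1)%:~R * kangle).

Let a (J : I) := kweight (intv J).

Definition knorm : R := \sum_(J : I) kweight (intv J) ^+ 2.

(** This is the squared modulus of [sum_J a_J e^{i(J, x - t)}] with [a_J = kweight (intv J)],
    expanded as a real double sum. Its frequencies lie in [[-N, N]^m]. *)
Definition kernel (x : 'rV[R]_m) : R :=
  \sum_(J : I) \sum_(J' : I) kweight (intv J) * kweight (intv J') *
    cos (dotZ (intv J - intv J') (x - t)).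

Lemma intv_inj : injective intv.
Proof.
move=> J J' /rowP h; apply/rowP => i; apply/val_inj.
by move: (h i); rewrite !mxE => -[].
Qed.

Lemma kernel_ge0 x : 0 <= kernel x.
Proof.
suff -> : kernel x = (\sum_J a J * cos (dotZ (intv J) (x - t))) ^+ 2 +
    (\sum_J a J * sin (dotZ (intv J) (x - t))) ^+ 2 by rewrite addr_ge0// sqr_ge0.
rewrite !expr2 !big_distrlr -big_split; apply: eq_bigr => J _.
rewrite -big_split; apply: eq_bigr => J' _.
rewrite dotZBl cosB /a /=; ring.
Qed.

Lemma kweight_ge0 (J : I) : 0 <= kweight (intv J).
Proof.
apply: prodr_ge0 => i _; apply: sin_ge0_pi.
rewrite mxE (_ : _%:~R = (J 0 i).+1%:R); last by rewrite intrD natr1.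
rewrite mulr_ge0 ?divr_ge0 ?pi_ge0//= /kangle mulrCA ler_piMr ?pi_ge0//.
by rewrite ler_pdivrMr// mul1r ler_nat ltnW// ltnS.
Qed.

Lemma knorm_gt0 : 0 < knorm.
Proof.
rewrite /knorm (bigD1 (const_mx ord0))//= ltr_wpDr//.
  by apply: sumr_ge0 => J _; exact: sqr_ge0.
rewrite exprn_gt0//; apply: prodr_gt0 => i _; rewrite !mxE add0r mul1r.
apply: sin_gt0_pi; rewrite divr_gt0 ?pi_gt0//=.
by rewrite ltr_pdivrMr// ltr_pMr ?pi_gt0// ltr1n.
Qed.

Lemma kweightDB (i : 'I_m) l :
  kweight (l + delta_mx 0 i) + kweight (l - delta_mx 0 i) = 2 * cos kangle * kweight l.
Proof.
have D l' : kweight l' = sin ((l' 0 i + 1)%:~R * kangle) *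
    \prod_(j < m | j != i) sin ((l' 0 j + 1)%:~R * kangle).
  by rewrite /kweight (bigD1 i).
rewrite !D.
have e l' : (l' = l + delta_mx 0 i \/ l' = l - delta_mx 0 i) ->
    \prod_(j < m | j != i) sin ((l' 0 j + 1)%:~R * kangle) =
    \prod_(j < m | j != i) sin ((l 0 j + 1)%:~R * kangle).
  move=> hl; apply: eq_bigr => j ji.
  by case: hl => ->; rewrite !mxE (negbTE ji) andbF ?subr0 ?addr0.
rewrite (e (l + _)) ?(e (l - _)); [|by right|by left].
have -> : (l + delta_mx 0 i) 0 i = l 0 i + 1 by rewrite !mxE !eqxx.
have -> : (l - delta_mx 0 i) 0 i = l 0 i - 1 by rewrite !mxE !eqxx.
rewrite -mulrDl [RHS]mulrA; congr (_ * _).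
set A := (l 0 i + 1)%:~R * kangle.
have -> : (l 0 i + 1 + 1)%:~R * kangle = A + kangle by rewrite intrD mulrDl mul1r.
have -> : (l 0 i - 1 + 1)%:~R * kangle = A - kangle.
  by rewrite /A subrK intrD mulrDl mul1r addrK.
by rewrite sinD sinB; ring.
Qed.

(** The sum over the box picks out the neighbour of [J] if it lies in the box. Otherwise the sum is
    empty of nonzero terms, and the weight of the neighbour is zero as well by the boundary values
    of the sine. *)
Lemma kweight_extend (J : I) (i : 'I_m) (e : int) : e = 1 \/ e = -1 ->
  \sum_(J' : I) (intv J' == intv J + e *: delta_mx 0 i)%:R * kweight (intv J')
  = kweight (intv J + e *: delta_mx 0 i).
Proof.
move=> he; set l := intv J + _.
have lj j : j != i -> l 0 j = (J 0 j : nat)%:Z.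
  by move=> ji; rewrite !mxE (negbTE ji) andbF mulr0 addr0.
have li : l 0 i = (J 0 i : nat)%:Z + e by rewrite !mxE !eqxx mulr1.
clearbody l.
have [[J' lJ']|nJ] := pselect (exists J', intv J' = l).
  rewrite (bigD1 J')//= lJ' eqxx mul1r big1 ?addr0// => J1 J1J'.
  by rewrite -lJ' (inj_eq intv_inj) (negbTE J1J') mul0r.
rewrite big1 => [|J' _]; last first.
  by case: eqP => [lJ'|]; rewrite ?mul0r//; case: nJ; exists J'.
suff : sin ((l 0 i + 1)%:~R * kangle) = 0.
  by move=> h; rewrite /kweight (bigD1 i)//= h mul0r.
have [li0|li0] := boolP ((0 <= l 0 i) && (l 0 i <= N%:Z)).
  case: nJ; exists (\row_j inord `|(l 0 j)%R|%N).
  apply/rowP => j; rewrite !mxE; have [->|ji] := eqVneq j i.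
    move: li0 => /andP[l0 lN]; rewrite inordK ?gez0_abs//.
    by move: l0 lN; move: (l 0 i) => z; lia.
  by rewrite lj// absz_nat inord_val.
have JN : (J 0 i : nat)%:Z <= N%:Z by rewrite lez_nat -ltnS ltn_ord.
(* A unit step that leaves [{0, ..., N}] lands on -1 or [N + 1], where the sine is taken at 0 or at
   pi. *)
have [->|->] : l 0 i = -1 \/ l 0 i = N.+1%:Z.
- rewrite negb_and -!ltNge in li0; rewrite li in li0 *.
  by case: he => he; rewrite he in li0 *; lia.
- by rewrite addNr mul0r sin0.
- rewrite (_ : N.+1%:Z + 1 = N.+2%:Z)//; last by lia.
  by rewrite /kangle mulrC divfK ?pnatr_eq0// sinpi.
Qed.

End Kernel.

(** * Moments of the kernel and the lower bound on windows of Fourier coefficients *)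

Section KernelIntegrals.
Variables (R : realType) (m N : nat) (t : 'rV[R]_m).
Local Notation I := 'rV['I_N.+1]_m.
Local Notation kern := (kernel R m N t).
Local Notation kw := (kweight R m N).
Local Notation zv := (intv m N).

Lemma l1_lipschitz_affine (l : 'rV[int]_m) (b : R) :
  l1_lipschitz R m (fun x => b + dotZ l x).
Proof. by apply: l1_lipschitzD; [exact: l1_lipschitz_cst|exact: l1_lipschitz_dotZ]. Qed.

Lemma int_Tm_trigpoly (T : finType) (c b : T -> R) (l : T -> 'rV[int]_m) :
  int_Tm (fun x => \sum_i c i * cos (b i + dotZ (l i) x)) =
  (2 * pi) ^+ m * \sum_i c i * ((l i == 0)%:R * cos (b i)).
Proof.
rewrite (@int_Tm_sum R m _ _ (fun i x => c i * cos (b i + dotZ (l i) x))).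
  rewrite mulr_sumr; apply: eq_bigr => i _.
  rewrite int_TmZ; last by apply: blip_cos; exact: l1_lipschitz_affine.
  by rewrite int_Tm_cos mulrCA.
by move=> i; apply: blipZ; apply: blip_cos; exact: l1_lipschitz_affine.
Qed.

Lemma kernelE x : kern x = \sum_(p : I * I) kw (zv p.1) * kw (zv p.2) *
  cos (- dotZ (zv p.1 - zv p.2) t + dotZ (zv p.1 - zv p.2) x).
Proof.
rewrite /kernel pair_bigA; apply: eq_bigr => p _.
by rewrite dotZBr addrC.
Qed.

Let kernel_funE : kern = (fun x => \sum_(p : I * I) kw (zv p.1) * kw (zv p.2) *
  cos (- dotZ (zv p.1 - zv p.2) t + dotZ (zv p.1 - zv p.2) x)).
Proof. by apply/funext => x; exact: kernelE. Qed.

Lemma blip_kernel : blip R m kern.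
Proof.
rewrite kernel_funE.
apply: blip_sum => p; apply: blipZ; apply: blip_cos; exact: l1_lipschitz_affine.
Qed.

Lemma int_Tm_kernel : int_Tm kern = (2 * pi) ^+ m * knorm R m N.
Proof.
rewrite kernel_funE.
rewrite int_Tm_trigpoly; congr (_ * _).
rewrite -(pair_bigA _ (fun J J' => kw (zv J) * kw (zv J') *
  ((zv J - zv J' == 0)%:R * cos (- dotZ (zv J - zv J') t)))) /=.
apply: eq_bigr => J _; rewrite (bigD1 J)//= big1 ?addr0 => [|J' J'J].
  by rewrite subrr eqxx dotZ0l oppr0 cos0 !mulr1 expr2.
by rewrite subr_eq0 (inj_eq (@intv_inj _ _)) eq_sym (negbTE J'J) mul0r mulr0.
Qed.

(** Multiplying by the cosine shifts each frequency by plus or minus the [i]-th unit vector, so only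
    pairs of neighbours [J], [J'] contribute. Summing the two neighbours of [J] with [kweightDB]
    gives [2 cos kangle] times the weight of [J]. *)
Lemma int_Tm_kernel_cos (i : 'I_m) :
  int_Tm (fun x => kern x * cos (x 0 i - t 0 i)) =
  (2 * pi) ^+ m * (cos (kangle R N) * knorm R m N).
Proof.
pose e := delta_mx 0 i : 'rV[int]_m.
pose l (q : bool * (I * I)) := zv q.2.1 - zv q.2.2 + (if q.1 then e else - e).
transitivity (int_Tm (fun x => \sum_q (2^-1 * (kw (zv q.2.1) * kw (zv q.2.2))) *
    cos (- dotZ (l q) t + dotZ (l q) x))).
  congr int_Tm; apply/funext => x.
  rewrite -(pair_bigA _ (fun b p => (2^-1 * (kw (zv p.1) * kw (zv p.2))) *
    cos (- dotZ (l (b, p)) t + dotZ (l (b, p)) x))) big_bool -big_split /=.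
  rewrite kernelE mulr_suml; apply: eq_bigr => p _.
  rewrite /l/=; set d := zv p.1 - zv p.2; set B := - dotZ d t + dotZ d x.
  have eE y : dotZ e y = y 0 i :> R by exact: dotZ_delta.
  rewrite (_ : - dotZ (d + e) t + dotZ (d + e) x = B + (x 0 i - t 0 i)); last first.
    by rewrite !(dotZDl _ _ d) !eE /B; ring.
  rewrite (_ : - dotZ (d - e) t + dotZ (d - e) x = B - (x 0 i - t 0 i)); last first.
    by rewrite !(dotZBl _ _ d) !eE /B; ring.
  by move: B (x 0 i - t 0 i) => {}B u; rewrite cosD cosB; field.
rewrite int_Tm_trigpoly; congr (_ * _).
rewrite -(pair_bigA _ (fun b p => (2^-1 * (kw (zv p.1) * kw (zv p.2))) *
    ((l (b, p) == 0)%:R * cos (- dotZ (l (b, p)) t)))) big_bool -big_split /=.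
have lE b p : (l (b, p) == 0)%:R * cos (- dotZ (l (b, p)) t) =
    (zv p.2 == zv p.1 + (if b then 1 else -1) *: e)%:R :> R.
  have -> : (zv p.2 == zv p.1 + (if b then 1 else -1) *: e) = (l (b, p) == 0).
    rewrite /l/= -(subr_eq0 (zv p.2)) -oppr_eq0 opprB addrAC.
    by case: b; rewrite ?scale1r ?scaleN1r.
  by case: eqP => [->|_]; rewrite ?mul0r// dotZ0l oppr0 cos0 mulr1.
under eq_bigr do rewrite !lE.
rewrite -(pair_bigA _ (fun J J' => 2^-1 * (kw (zv J) * kw (zv J')) *
    (zv J' == zv J + 1 *: e)%:R + 2^-1 * (kw (zv J) * kw (zv J')) *
    (zv J' == zv J + -1 *: e)%:R)) /= mulr_sumr.
apply: eq_bigr => J _; rewrite big_split/=.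
have H c : c = 1 \/ c = -1 -> \sum_J' 2^-1 * (kw (zv J) * kw (zv J')) *
    (zv J' == zv J + c *: e)%:R = 2^-1 * kw (zv J) * kw (zv J + c *: e).
  move=> hc; rewrite -kweight_extend// mulr_sumr; apply: eq_bigr => J' _.
  by rewrite /e; ring.
rewrite !H; [|by right|by left].
by rewrite -mulrDr scale1r scaleN1r kweightDB; field.
Qed.

Variables (phi : 'rV[R]_m -> R) (lam : R).
Hypothesis phi_lip : l1_lipschitz R m phi.
Let gam k := fourier_abs (expi_re lam phi) (expi_im lam phi) k.

Let lip_phase (k : 'rV[int]_m) b :
  l1_lipschitz R m (fun x => lam * phi x - dotZ k x - b).
Proof.
apply: (@l1_lipschitzD _ _ (fun x => lam * phi x - dotZ k x) (fun=> - b)).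
  apply: (@l1_lipschitzD _ _ (fun x => lam * phi x) (fun x => - dotZ k x)).
    exact: l1_lipschitzZ.
  under eq_fun do rewrite -mulN1r.
  by apply: l1_lipschitzZ; exact: l1_lipschitz_dotZ.
exact: l1_lipschitz_cst.
Qed.

(** A Schur test: the integrand splits into phases of frequency [k0 + (J - J')] and [k0 - (J - J')],
    each integral is at most the modulus of a Fourier coefficient, and [G] bounds the row and column
    sums of the resulting matrices. *)
Lemma int_Tm_kernel_phase (k0 : 'rV[int]_m) (al G : R) :
  (forall J : I, \sum_(J' : I) gam (k0 + zv J - zv J') <= G) ->
  (forall J : I, \sum_(J' : I) gam (k0 + zv J' - zv J) <= G) ->
  int_Tm (fun x => kern x * cos (lam * phi x - dotZ k0 x - al)) <=
  (2 * pi) ^+ m * (knorm R m N * G).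
Proof.
move=> hG1 hG2.
have pi20 : 0 <= (2 * pi) ^+ m :> R by rewrite exprn_ge0// mulr_ge0// pi_ge0.
pose A s (p : I * I) x := cos (lam * phi x -
  dotZ (k0 + s *: (zv p.1 - zv p.2)) x - (al - dotZ (s *: (zv p.1 - zv p.2)) t)).
have bA s p : blip R m (A s p) by apply: blip_cos; exact: lip_phase.
have intA s p : int_Tm (A s p) <= (2 * pi) ^+ m * gam (k0 + s *: (zv p.1 - zv p.2)).
  by rewrite (le_trans (ler_norm _))//; exact: int_Tm_cos_phase.
have -> : (fun x => kern x * cos (lam * phi x - dotZ k0 x - al)) =
    (fun x => \sum_p (2^-1 * (kw (zv p.1) * kw (zv p.2))) * (A 1 p x + A (-1) p x)).
  apply/funext => x; rewrite kernelE mulr_suml; apply: eq_bigr => p _.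
  rewrite /A scale1r scaleN1r; set d := zv p.1 - zv p.2.
  set B := lam * phi x - dotZ k0 x - al.
  rewrite !(dotZDl _ _ k0) !(dotZNl _ _ d).
  rewrite (_ : lam * phi x - (dotZ k0 x + dotZ d x) - (al - dotZ d t) =
    B - (- dotZ d t + dotZ d x)); last by rewrite /B; ring.
  rewrite (_ : lam * phi x - (dotZ k0 x - dotZ d x) - (al - - dotZ d t) =
    B + (- dotZ d t + dotZ d x)); last by rewrite /B; ring.
  by move: B (- dotZ d t + dotZ d x) => {}B u; rewrite cosB cosD; field.
rewrite (@int_Tm_sum R m _ _ (fun p x => _ * (A 1 p x + A (-1) p x))); last first.
  by move=> p; apply: blipZ; exact: blipD.
pose g s (p : I * I) := gam (k0 + s *: (zv p.1 - zv p.2)).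
have g0 s p : 0 <= g s p by exact: sqrtr_ge0.
have bound p : int_Tm (fun x => 2^-1 * (kw (zv p.1) * kw (zv p.2)) *
    (A 1 p x + A (-1) p x)) <= (2 * pi) ^+ m *
    (4^-1 * (kw (zv p.1) ^+ 2 * g 1 p + kw (zv p.1) ^+ 2 * g (-1) p +
      (kw (zv p.2) ^+ 2 * g 1 p + kw (zv p.2) ^+ 2 * g (-1) p))).
  rewrite int_TmZ; last exact: blipD.
  rewrite int_TmD//.
  have w0 : 0 <= 2^-1 * (kw (zv p.1) * kw (zv p.2)).
    by rewrite !mulr_ge0// ?kweight_ge0.
  apply: le_trans (ler_wpM2l w0 (lerD (intA 1 p) (intA (-1) p))) _.
  rewrite -mulrDr mulrCA ler_wpM2l//.
  (* The product of the two weights is at most half the sum of their squares, which separates [J]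
     from [J']. *)
  have : 0 <= (g 1 p + g (-1) p) * (kw (zv p.1) - kw (zv p.2)) ^+ 2.
    by rewrite mulr_ge0 ?sqr_ge0 ?addr_ge0.
  rewrite -/(g 1 p) -/(g (-1) p); lra.
apply: le_trans (ler_sum _ (fun p _ => bound p)) _.
rewrite -mulr_sumr ler_wpM2l// -mulr_sumr !big_split/=.
have sum1 s : s = 1 \/ s = -1 ->
    \sum_(p : I * I) kw (zv p.1) ^+ 2 * g s p <= knorm R m N * G.
  move=> hs; rewrite -(pair_bigA _ (fun J J' => kw (zv J) ^+ 2 * g s (J, J')))/=.
  rewrite /knorm mulr_suml; apply: ler_sum => J _; rewrite -mulr_sumr.
  rewrite ler_wpM2l ?sqr_ge0// /g; case: hs => ->/=.
    by under eq_bigr do rewrite scale1r addrA.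
  by under eq_bigr do rewrite scaleN1r opprB addrA.
have sum2 s : s = 1 \/ s = -1 ->
    \sum_(p : I * I) kw (zv p.2) ^+ 2 * g s p <= knorm R m N * G.
  move=> hs; rewrite -(pair_bigA _ (fun J J' => kw (zv J') ^+ 2 * g s (J, J')))/=.
  rewrite exchange_big /knorm mulr_suml; apply: ler_sum => J _; rewrite -mulr_sumr.
  rewrite ler_wpM2l ?sqr_ge0// /g; case: hs => ->/=.
    by under eq_bigr do rewrite scale1r addrA.
  by under eq_bigr do rewrite scaleN1r opprB addrA.
have := sum1 1 (or_introl erefl); have := sum1 (-1) (or_intror erefl).
have := sum2 1 (or_introl erefl); have := sum2 (-1) (or_intror erefl).
lra.
Qed.

(** The pointwise bound is integrated against the kernel, under which [1 - cos (x_i - t_i)] has mean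
    exactly [1 - cos kangle]; the other side is at most [G] after division by the mass of the
    kernel. *)
Lemma fourier_window_lower_bound (k0 : 'rV[int]_m) (al D G : R) :
  (forall x : 'rV[R]_m, 2^-1 - D * \sum_(i < m) (1 - cos (x 0 i - t 0 i)) <=
             cos (lam * phi x - dotZ k0 x - al)) ->
  (forall J : I, \sum_(J' : I) gam (k0 + zv J - zv J') <= G) ->
  (forall J : I, \sum_(J' : I) gam (k0 + zv J' - zv J) <= G) ->
  2^-1 - D * (m%:R * (1 - cos (kangle R N))) <= G.
Proof.
move=> hcos hG1 hG2.
have pi20 : 0 < (2 * pi) ^+ m :> R by rewrite exprn_gt0// mulr_gt0// pi_gt0.
have bK := blip_kernel.
have bc i : blip R m (fun x => kern x * cos (x 0 i - t 0 i)).
  apply: blipM => //; apply: (@blip_cos _ _ (fun x => x 0 i - t 0 i)).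
  under eq_fun do rewrite -dotZ_delta addrC; exact: l1_lipschitz_affine.
have : int_Tm (fun x => (2^-1 - D * m%:R) * kern x +
    D * \sum_(i < m) kern x * cos (x 0 i - t 0 i)) <=
    int_Tm (fun x => kern x * cos (lam * phi x - dotZ k0 x - al)).
  apply: le_int_Tm.
  - by apply: blipD; apply: blipZ => //; apply: blip_sum.
  - by apply: blipM => //; apply: blip_cos; exact: lip_phase.
  - move=> x; have := ler_wpM2l (kernel_ge0 R m N t x) (hcos x).
    rewrite sumrB -mulr_sumr big_const_ord iter_addr_0; lra.
rewrite int_TmD; [|exact: blipZ|by apply: blipZ; apply: blip_sum].
rewrite !int_TmZ//; last exact: blip_sum.
rewrite (@int_Tm_sum R m _ _ (fun i x => kern x * cos (x 0 i - t 0 i)))//.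
rewrite int_Tm_kernel; under eq_bigr do rewrite int_Tm_kernel_cos.
rewrite big_const_ord iter_addr_0 => h.
have := le_trans h (int_Tm_kernel_phase k0 al G hG1 hG2).
have -> : (2^-1 - D * m%:R) * ((2 * pi) ^+ m * knorm R m N) +
   D * ((2 * pi) ^+ m * (cos (kangle R N) * knorm R m N) *+ m) =
   (2 * pi) ^+ m * (knorm R m N * (2^-1 - D * (m%:R * (1 - cos (kangle R N))))).
  by rewrite -mulr_natr; ring.
by rewrite ler_pM2l// ler_pM2l// knorm_gt0.
Qed.

End KernelIntegrals.

(** * Local linearization of the phase *)

Section PhaseEstimate.
Variables (R : realType) (m : nat).
Implicit Types (x y t : 'rV[R]_m).

Lemma sum_ord_le (F : 'I_m -> R) (b : R) :
  (forall i, F i <= b) -> \sum_(i < m) F i <= m%:R * b.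
Proof.
move=> hF; apply: le_trans (ler_sum _ (fun i _ => hF i)) _.
by rewrite sumr_const card_ord mulr_natl.
Qed.

Lemma MVT_norm (g dg : R -> R) (a b : R) :
  (forall s : R, is_derive s 1 g (dg s)) ->
  exists c : R, `|c - a| <= `|b - a| /\ g b - g a = dg c * (b - a).
Proof.
move=> hg.
have cg : continuous g.
  by move=> s; apply/differentiable_continuous/derivable1_diffP.
have H (u v : R) : u <= v -> exists2 c, u <= c <= v & g v - g u = dg c * (v - u).
  move=> uv; have hd (s : R) : s \in `]u, v[ -> is_derive s 1 g (dg s) by move=> _.
  have [c] := MVT_segment uv hd (continuous_subspaceT cg).
  by rewrite in_itv/= => cuv e; exists c.
have [ab|/ltW ba] := leP a b.
  have [c /andP[ac cb] e] := H _ _ ab; exists c; split=> //.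
  by rewrite !ger0_norm ?subr_ge0// lerB.
have [c /andP[bc ca] e] := H _ _ ba; exists c; split.
  by rewrite !ler0_norm ?subr_le0// lerN2 lerB.
by rewrite -(opprB (g a)) e -mulrN opprB.
Qed.

Lemma is_derive_line (phi : 'rV[R]_m -> R) x v (s : R) :
  derivable phi (x + s *: v) v ->
  is_derive s 1 (fun s : R => phi (x + s *: v)) ('D_v phi (x + s *: v)).
Proof.
move=> h.
have E : (fun h : R => h^-1 *:
      (((fun s : R => phi (x + s *: v)) \o shift s) (h *: (1 : R)) -
      phi (x + s *: v))) =
    (fun h => h^-1 *: ((phi \o shift (x + s *: v)) (h *: v) - phi (x + s *: v))).
  apply/funext => k /=; congr (_ *: (phi _ - _)).
  rewrite (_ : k *: (1 : R) = k); last exact: mulr1.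
  by rewrite scalerDl addrCA.
split; first by rewrite /derivable E.
by rewrite /derive E.
Qed.

(** Passing from [x] to [y] one coordinate at a time needs partial derivatives only, at the price of
    a separate intermediate point for each coordinate. *)
Lemma mean_value_coord (phi : 'rV[R]_m -> R) x y :
  (forall j z, derivable phi z (evec R j)) ->
  exists z : 'I_m -> 'rV[R]_m,
    (forall j i, `|z j 0 i - x 0 i| <= `|y 0 i - x 0 i|) /\
    phi y - phi x = \sum_(j < m) 'D_(evec R j) phi (z j) * (y 0 j - x 0 j).
Proof.
move=> hphi.
pose w (k : nat) : 'rV[R]_m := \row_i (if (i < k)%N then y 0 i else x 0 i).
have wS (j : 'I_m) : w j.+1 = w j + (y 0 j - x 0 j) *: evec R j.
  apply/rowP => i; rewrite !mxE ltnS eqxx /=.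
  have [->|ij] := eqVneq i j; first by rewrite leqnn ltnn mulr1 addrC subrK.
  by rewrite mulr0 addr0 leq_eqVlt (_ : (i == j :> nat) = false)//; apply/negbTE.
have H (j : 'I_m) : exists z : 'rV[R]_m,
    (forall i, `|z 0 i - x 0 i| <= `|y 0 i - x 0 i|) /\
    phi (w j.+1) - phi (w j) = 'D_(evec R j) phi z * (y 0 j - x 0 j).
  have hd (s : R) := @is_derive_line phi (w j) (evec R j) s (hphi j _).
  have [c []] := MVT_norm _ _ 0 (y 0 j - x 0 j) hd.
  rewrite !subr0 scale0r addr0 -wS => cle e.
  exists (w j + c *: evec R j); split=> // i.
  rewrite !mxE eqxx /=; have [->|ij] := eqVneq i j.
    by rewrite ltnn mulr1 addrAC subrr add0r.
  by rewrite mulr0 addr0; case: ifP => // _; rewrite subrr normr0.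
have [z hz] := choice H; exists z; split; first by move=> j; exact: (hz j).1.
transitivity (\sum_(j < m) (phi (w j.+1) - phi (w j))); last first.
  by apply: eq_bigr => j _; exact: (hz j).2.
rewrite -(big_mkord xpredT (fun j => phi (w j.+1) - phi (w j))) telescope_sumr//.
by congr (phi _ - phi _); apply/rowP => i; rewrite !mxE ?ltn_ord.
Qed.

Lemma edist_le_sum x y : Defs.edist x y <= \sum_(i < m) `|x 0 i - y 0 i|.
Proof.
have S0 : 0 <= \sum_(i < m) `|x 0 i - y 0 i| by exact: sumr_ge0.
rewrite -(ger0_norm S0) -sqrtr_sqr ler_wsqrtr// expr2 mulr_suml.
apply: ler_sum => i _; rewrite -(real_normK (num_real _)) expr2 ler_wpM2l//.
by rewrite (bigD1 i)//= lerDl sumr_ge0.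
Qed.

Lemma periodic_shift (phi : 'rV[R]_m -> R) (n : 'rV[int]_m) x :
  periodic_Tm phi -> phi (x + \row_i (2 * pi * (n 0 i)%:~R)) = phi x.
Proof.
move=> per.
have pernat (j : 'I_m) (k : nat) y : phi (y + (2 * pi * k%:R) *: evec R j) = phi y.
  elim: k => [|k IH]; first by rewrite mulr0 scale0r addr0.
  by rewrite -(natr1 k) mulrDr mulr1 scalerDl addrA per.
have perint (j : 'I_m) (k : int) y : phi (y + (2 * pi * k%:~R) *: evec R j) = phi y.
  case: k => k; first exact: pernat.
  rewrite NegzE mulrNz mulrN scaleNr.
  by rewrite -[X in _ = phi X](subrK ((2 * pi * k.+1%:R) *: evec R j) y) pernat.
have -> : \row_i (2 * pi * (n 0 i)%:~R) =
    \sum_(j < m) (2 * pi * (n 0 j)%:~R) *: evec R j.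
  by rewrite [LHS]row_sum_delta; apply: eq_bigr => j _; rewrite mxE.
elim: (index_enum _) x => [|j r IH] x; first by rewrite big_nil addr0.
by rewrite big_cons addrA IH perint.
Qed.

Lemma derive_periodic_shift (phi : 'rV[R]_m -> R) (n : 'rV[int]_m) x v :
  periodic_Tm phi ->
  'D_v phi (x + \row_i (2 * pi * (n 0 i)%:~R)) = 'D_v phi x.
Proof.
move=> per; set p := \row_i _.
have E : (fun h : R => h^-1 *: ((phi \o shift (x + p)) (h *: v) - phi (x + p))) =
    (fun h => h^-1 *: ((phi \o shift x) (h *: v) - phi x)).
  by apply/funext => h /=; rewrite addrA !periodic_shift.
by rewrite /derive E.
Qed.

Lemma reduce_mod_2pi (s : R) : exists n : int, `|s - 2 * pi * n%:~R| <= pi.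
Proof.
have pi20 : 0 < 2 * pi :> R by rewrite mulr_gt0// pi_gt0.
(* Adding 1/2 before taking the floor rounds [s / (2 * pi)] to a nearest integer. *)
exists (Num.floor (s / (2 * pi) + 2^-1)).
set n := Num.floor _; set u := s / (2 * pi) + 2^-1.
have h1 : n%:~R <= u by exact: floor_le.
have h2 : u < (n + 1)%:~R by exact: floorD1_gt.
have -> : s = (u - 2^-1) * (2 * pi) by rewrite /u addrK divfK ?gt_eqF.
rewrite intrD in h2; rewrite (_ : _ - _ = (u - 2^-1 - n%:~R) * (2 * pi)); last by ring.
rewrite normrM (gtr0_norm pi20).
have : `|u - 2^-1 - n%:~R| <= 2^-1 by rewrite ler_norml; lra.
move=> /(ler_wpM2r (ltW pi20)); lra.
Qed.

Lemma reduce_mod_2pi_vec x t : exists n : 'rV[int]_m, forall i,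
  `|(x + \row_i (2 * pi * (n 0 i)%:~R)) 0 i - t 0 i| <= pi.
Proof.
have [n hn] := choice (fun i : 'I_m => reduce_mod_2pi (x 0 i - t 0 i)).
exists (\row_i - n i) => i; rewrite !mxE mulrNz mulrN addrAC; exact: hn.
Qed.

Variables (omega : R -> R) (phi : 'rV[R]_m -> R).
Hypothesis phi_C1 : C1omega_T omega phi.

Let per : periodic_Tm phi := phi_C1.1.
Let dphi j x : derivable phi x (evec R j) := (phi_C1.2 j).1 x.

(** The sum of the absolute values of the constants and the minimum of the thresholds serve all
    coordinates at once; nonnegativity of [omega d] allows the constant to be enlarged. *)
Lemma uniform_modulus : exists C d0 : R, [/\ 0 <= C, 0 < d0 &
  forall j x y d, 0 < d -> d <= d0 -> 0 <= omega d -> Defs.edist x y <= d ->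
    `|'D_(evec R j) phi x - 'D_(evec R j) phi y| <= C * omega d].
Proof.
have H (j : 'I_m) : exists p : R * R, 0 < p.2 /\ forall d, 0 < d -> d <= p.2 ->
    forall x y, Defs.edist x y <= d ->
    `|'D_(evec R j) phi x - 'D_(evec R j) phi y| <= p.1 * omega d.
  by have [_ [C [d0 h]]] := phi_C1.2 j; exists (C, d0).
have [f hf] := choice H.
have [d0 [d00 hd0]] : exists d0 : R, 0 < d0 /\ forall j, d0 <= (f j).2.
  have : forall r : seq 'I_m, exists d0 : R, 0 < d0 /\ forall j, j \in r -> d0 <= (f j).2.
    elim=> [|j r [d [d0 hd]]]; first by exists 1.
    exists (Num.min d (f j).2); rewrite lt_min d0 (hf j).1; split=> // i.
    by rewrite in_cons ge_min => /predU1P[->|/hd->//]; rewrite lexx orbT.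
  move=> /(_ (index_enum _)) [d [d0 hd]]; exists d; split=> // j.
  by apply: hd; rewrite mem_index_enum.
exists (\sum_j `|(f j).1|), d0; split=> //; first exact: sumr_ge0.
move=> j x y d dpos dd0 om0 xy.
apply: le_trans ((hf j).2 d dpos (le_trans dd0 (hd0 j)) x y xy) _.
rewrite ler_wpM2r// (le_trans (ler_norm _))//.
by rewrite (bigD1 j)//= lerDl sumr_ge0.
Qed.

(* The point [0] is joined to the representative of [x] in [-pi, pi]^m by [K] steps
   of length at most [d0]. *)
Lemma derive_bounded (C d0 : R) : 0 < d0 -> 0 <= omega d0 ->
  (forall j x y, Defs.edist x y <= d0 ->
    `|'D_(evec R j) phi x - 'D_(evec R j) phi y| <= C * omega d0) ->
  exists B : R, forall j x, `|'D_(evec R j) phi x| <= B.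
Proof.
move=> d00 om0 hC.
pose K := (Num.truncn (m%:R * pi / d0)).+1.
have K0 : 0 < K%:R :> R by rewrite ltr0n.
have hK : m%:R * pi <= K%:R * d0.
  by rewrite -ler_pdivrMr// ltW// truncnS_gt.
exists (\sum_j `|'D_(evec R j) phi 0| + K%:R * (C * omega d0)) => j x.
have [n hn] := reduce_mod_2pi_vec x 0.
rewrite -(@derive_periodic_shift phi n)//; set y := x + _ in hn *; clearbody y.
have step k : `|'D_(evec R j) phi ((k%:R / K%:R) *: y) - 'D_(evec R j) phi 0| <=
    k%:R * (C * omega d0).
  elim: k => [|k IH]; first by rewrite !mul0r scale0r subrr normr0.
  set a := 'D__ _ _; set b := 'D__ _ 0; pose c := 'D_(evec R j) phi ((k%:R / K%:R) *: y).
  have -> : a - b = (a - c) + (c - b) by ring.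
  rewrite (le_trans (ler_normD _ _))// -natr1 mulrDl mul1r addrC lerD//.
  apply: hC; rewrite (le_trans (edist_le_sum _ _))//.
  have -> : d0 = K%:R^-1 * (K%:R * d0) by rewrite mulKf ?gt_eqF.
  have Ki0 : 0 <= K%:R^-1 :> R by rewrite invr_ge0 ltW.
  apply: le_trans (ler_wpM2l Ki0 hK).
  rewrite mulrCA; apply: sum_ord_le => i.
  rewrite !mxE -mulrBl -mulrBl -natr1 addrAC subrr add0r mul1r.
  rewrite normrM (ger0_norm Ki0) ler_wpM2l//.
  by have := hn i; rewrite mxE subr0.
have := step K; rewrite divff ?gt_eqF// scale1r => h.
set a := 'D__ _ y in h *; set b := 'D__ _ 0 in h.
have -> : a = b + (a - b) by ring.
rewrite (le_trans (ler_normD _ _))// lerD//.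
by rewrite (bigD1 j)//= lerDl sumr_ge0.
Qed.

Lemma l1_lipschitz_of_derive (B : R) :
  (forall j x, `|'D_(evec R j) phi x| <= B) -> l1_lipschitz R m phi.
Proof.
move=> hB; exists B => x y.
have [z [_ ->]] := mean_value_coord _ y x dphi.
rewrite (le_trans (ler_norm_sum _ _ _))// mulr_sumr.
by apply: ler_sum => i _; rewrite normrM ler_wpM2r.
Qed.

(** Each partial derivative of [lam phi - (k0, .)] near [t] is an oscillation of size at most
    [|lam| * E] plus an error at most 1 from replacing [lam grad phi(t)] by [k0]. *)
Lemma phase_local_bound (k0 : 'rV[int]_m) (lam rho E : R) t x :
  (forall i, `|lam * 'D_(evec R i) phi t - (k0 0 i)%:~R| <= 1) ->
  (forall (j : 'I_m) (z : 'rV[R]_m), (forall i, `|z 0 i - t 0 i| <= rho) ->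
     `|'D_(evec R j) phi z - 'D_(evec R j) phi t| <= E) ->
  (forall i, `|x 0 i - t 0 i| <= rho) ->
  `|lam * phi x - dotZ k0 x - (lam * phi t - dotZ k0 t)| <=
    m%:R * ((`|lam| * E + 1) * rho).
Proof.
move=> hk hE hx.
have [z [hz e]] := mean_value_coord _ t x dphi.
have -> : lam * phi x - dotZ k0 x - (lam * phi t - dotZ k0 t) =
    \sum_(j < m) (lam * ('D_(evec R j) phi (z j) - 'D_(evec R j) phi t) +
      (lam * 'D_(evec R j) phi t - (k0 0 j)%:~R)) * (x 0 j - t 0 j).
  transitivity (lam * (phi x - phi t) - dotZ k0 (x - t)).
    by rewrite dotZBr; ring.
  rewrite e /dotZ mulr_sumr -sumrB; apply: eq_bigr => j _.
  by rewrite !mxE; ring.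
rewrite (le_trans (ler_norm_sum _ _ _))//.
apply: sum_ord_le => j; rewrite normrM ler_pM//.
rewrite (le_trans (ler_normD _ _))// lerD// normrM ler_wpM2l//.
by apply: hE => i; exact: le_trans (hz _ _) (hx _).
Qed.

(* Modulo 2 pi, either [x] is in the cube of half-side [rho] around [t], where the
   phase is at most 1 in absolute value, or the left-hand side is at most -1. *)
Lemma cos_phase_lower_bound (k0 : 'rV[int]_m) (lam rho E : R) t :
  0 < rho -> rho <= 1 ->
  (forall i, `|lam * 'D_(evec R i) phi t - (k0 0 i)%:~R| <= 1) ->
  (forall (j : 'I_m) (z : 'rV[R]_m), (forall i, `|z 0 i - t 0 i| <= rho) ->
     `|'D_(evec R j) phi z - 'D_(evec R j) phi t| <= E) ->
  m%:R * ((`|lam| * E + 1) * rho) <= 1 ->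
  forall x : 'rV[R]_m,
    2^-1 - 2 / (1 - cos rho) * \sum_(i < m) (1 - cos (x 0 i - t 0 i)) <=
    cos (lam * phi x - dotZ k0 x - (lam * phi t - dotZ k0 t)).
Proof.
move=> rho0 rho1 hk hE hle x.
have c0 : 0 < 1 - cos rho.
  by apply: lt_le_trans (one_sub_cos_ge _ _ (ltW rho0) rho1); rewrite divr_gt0// exprn_gt0.
have sum0 : 0 <= \sum_(i < m) (1 - cos (x 0 i - t 0 i)).
  by apply: sumr_ge0 => i _; rewrite subr_ge0 cos_le1.
have [n hn] := reduce_mod_2pi_vec x t.
set y := x + _ in hn.
have cosE : cos (lam * phi x - dotZ k0 x - (lam * phi t - dotZ k0 t)) =
    cos (lam * phi y - dotZ k0 y - (lam * phi t - dotZ k0 t)).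
  (* Since [k0] and [n] are integer vectors, the translation changes [(k0, x)] by an integer
     multiple of [2 pi]. *)
  pose q : int := \sum_(i < m) k0 0 i * n 0 i.
  have dE : dotZ k0 y = dotZ k0 x + 2 * pi * q%:~R.
    rewrite /dotZ /q rmorph_sum mulr_sumr -big_split; apply: eq_bigr => i _ /=.
    by rewrite !mxE intrM; ring.
  rewrite /y periodic_shift// -/y dE.
  by rewrite -[RHS](cosD2piz _ _ q); congr cos; ring.
have sumE : \sum_(i < m) (1 - cos (x 0 i - t 0 i)) =
    \sum_(i < m) (1 - cos (y 0 i - t 0 i)).
  by apply: eq_bigr => i _; rewrite !mxE addrAC cosD2piz.
rewrite cosE; rewrite sumE in sum0 *.
have D0 : 0 < 2 / (1 - cos rho) by rewrite divr_gt0.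
have [hy|/forallPn[i]] := boolP [forall i, `|y 0 i - t 0 i| <= rho].
  have {}hy i : `|y 0 i - t 0 i| <= rho by exact: (forallP hy).
  have hA := le_trans (phase_local_bound _ _ _ _ _ _ hk hE hy) hle.
  set A := _ - _ - _ in hA *.
  have A2 : A ^+ 2 <= 1 by rewrite -(real_normK (num_real A)) expr_le1.
  have := cos_ge_quadratic _ A.
  have := mulr_ge0 (ltW D0) sum0; lra.
rewrite -ltNge => hi.
(* The [i]-th term alone suffices, as the cosine decreases on [[0, pi]]. The factor
   [2 / (1 - cos rho)] then makes the left-hand side at most [1/2 - 2]. *)
have : 1 - cos rho <= \sum_(i < m) (1 - cos (y 0 i - t 0 i)).
  rewrite (bigD1 i)//= -[leLHS]addr0 lerD//; last first.
    by apply: sumr_ge0 => j _; rewrite subr_ge0 cos_le1.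
  have rho_pi : rho <= pi by rewrite (le_trans rho1)// (le_trans _ (pi_ge2 R)) ?ler1n.
  rewrite lerD2l lerN2 -(cos_norm (_ - _)) ltW// ltr_cos// in_itv/=.
    by rewrite (ltW rho0).
  by rewrite hn andbT.
move=> /(ler_wpM2l (ltW D0)); rewrite divfK ?gt_eqF// => h.
have := cos_geN1 (lam * phi y - dotZ k0 y - (lam * phi t - dotZ k0 t)); lra.
Qed.

End PhaseEstimate.

(** * Counting frequency cubes *)

Section Counting.
Variables (R : realType) (m N : nat).

Lemma sum_le_esum (T : choiceType) (f : T -> R) (r : seq T) :
  uniq r -> ((\sum_(k <- r) f k)%:E <= esum [set: T] (fun k => (f k)%:E))%E.
Proof.
move=> ur; apply: esum_ge; exists [set` r].
  by split=> //; exact: finite_seq.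
by rewrite -fsbig_seq// sumEFin.
Qed.

Lemma divz_rem_inj (z z' : int) (s s' : 'I_N.+1) :
  N.+1%:Z * z + (s : nat)%:Z = N.+1%:Z * z' + (s' : nat)%:Z -> z = z' /\ s = s'.
Proof.
move=> e; have quo (y : int) (u : 'I_N.+1) :
    ((N.+1%:Z * y + (u : nat)%:Z) %/ N.+1%:Z)%Z = y.
  by rewrite mulrC divzMDl// divz_small ?addr0// absz_nat; have := ltn_ord u; lia.
have zz : z = z' by rewrite -[LHS](quo z s) e quo.
by split=> //; apply/val_inj; move: e; rewrite zz => /addrI [].
Qed.

(* The 3^m cubes of side [N + 1] around the one with index [q], parametrized by the
   choice of a cube and of a point in it. *)
Definition window (q : 'rV[int]_m) (u : 'rV['I_3]_m * 'rV['I_N.+1]_m) : 'rV[int]_m :=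
  \row_i (N.+1%:Z * (q 0 i + (u.1 0 i : nat)%:Z - 1) + (u.2 0 i : nat)%:Z).

(** The [g J] are distinct points of the window, so the left-hand side is a partial sum of
    nonnegative terms. Both the row and the column sums of the Schur test are thereby bounded by one
    window sum. *)
Lemma window_sum_ge (f : 'rV[int]_m -> R) (I : finType) (g : I -> 'rV[int]_m)
    (q : 'rV[int]_m) : (forall k, 0 <= f k) -> injective g ->
  (forall J i, N.+1%:Z * (q 0 i - 1) <= g J 0 i /\ g J 0 i < N.+1%:Z * (q 0 i + 2)) ->
  \sum_J f (g J) <= \sum_u f (window q u).
Proof.
move=> f0 ginj hg.
have [h hK] : {h | forall J, window q (h J) = g J}.
  suff hw J : exists u, window q u = g J by have [h hK] := choice hw; exists h.
  have H i : exists u : 'I_3 * 'I_N.+1, g J 0 i =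
      N.+1%:Z * (q 0 i + (u.1 : nat)%:Z - 1) + (u.2 : nat)%:Z.
    have [h1 h2] := hg J i.
    (* The offset from the lowest corner: its quotient by [N + 1] selects one of the three cubes,
       its remainder the point inside. *)
    set x := g J 0 i - N.+1%:Z * (q 0 i - 1).
    have x0 : 0 <= x by rewrite /x subr_ge0.
    have x3 : x < N.+1%:Z * 3.
      rewrite /x; move: h2; rewrite !mulrDr; move: (N.+1%:Z * q 0 i) => y; lia.
    have L0 : N.+1%:Z != 0 by [].
    have dv := divz_eq x N.+1%:Z.
    have r0 := modz_ge0 x L0; have r1 := ltz_pmod x (ltn0Sn N : (0 < N.+1%:Z)).
    have d0 : 0 <= (x %/ N.+1%:Z)%Z by rewrite divz_ge0.
    have d3 : (x %/ N.+1%:Z)%Z < 3 by rewrite ltz_divLR// mulrC.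
    have d3' : (`|(x %/ N.+1%:Z)%Z| < 3)%N by lia.
    have r3' : (`|(x %% N.+1%:Z)%Z| < N.+1)%N by lia.
    exists (Ordinal d3', Ordinal r3') => /=.
    rewrite !gez0_abs// addrAC mulrDr -addrA [N.+1%:Z * (x %/ _)%Z]mulrC -dv.
    by rewrite /x addrC subrK.
  have [u hu] := choice H.
  exists (\row_i (u i).1, \row_i (u i).2); apply/rowP => i.
  by rewrite hu !mxE.
have hinj : injective h by move=> J J' e; apply: ginj; rewrite -!hK e.
under eq_bigr do rewrite -hK.
rewrite -(big_imset (fun u => f (window q u)))/=; last by move=> J J' _ _; exact: hinj.
rewrite [leRHS](bigID (mem (h @: I)))/= lerDl; exact: sumr_ge0.
Qed.

(* With [a] half the average of the [x]'s, this bounds [sum x^p] from below by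
   [sum x] and replaces Hoelder's inequality. *)
Lemma powR_ge_linear (p a x : R) : 1 <= p -> 0 < a -> 0 <= x ->
  a `^ (p - 1) * (x - a) <= x `^ p.
Proof.
move=> p1 a0 x0; have [xa|ax] := leP x a.
  by rewrite (@le_trans _ _ 0) ?powR_ge0// mulr_ge0_le0 ?powR_ge0// subr_le0.
rewrite -(@mulr_powRB1 _ x p)//; last exact: lt_le_trans ltr01 p1.
rewrite mulrC; apply: ler_pM; rewrite ?powR_ge0 ?subr_ge0 ?(ltW ax)//.
  by rewrite gerDl oppr_le0 ltW.
by rewrite ge0_ler_powR ?nnegrE ?subr_ge0 ?(ltW a0) ?(ltW ax).
Qed.

(** As [b] is at most half the average, subtracting [b] from every term leaves at least half of the
    sum. *)
Lemma sum_powR_ge (T : finType) (f : T -> R) (p b : R) : 1 <= p -> 0 < b ->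
  (forall u, 0 <= f u) -> 2 * (#|T|%:R * b) <= \sum_u f u ->
  b `^ (p - 1) * (#|T|%:R * b) <= \sum_u f u `^ p.
Proof.
move=> p1 b0 f0 hf.
apply: le_trans (ler_sum _ (fun u _ => powR_ge_linear p b (f u) p1 b0 (f0 u))).
rewrite -mulr_sumr ler_wpM2l ?powR_ge0// sumrB sumr_const -mulr_natl cardT -cardE; lra.
Qed.

(** Each window carries a fixed amount of the sum of [p]-th powers, while all windows together carry
    at most [3 ^+ m * S], each frequency being counted at most [3 ^+ m] times. *)
Lemma count_windows (gam : 'rV[int]_m -> R) (p S : R) (F : seq 'rV[int]_m) :
  1 <= p -> (forall k, 0 <= gam k) ->
  (forall r : seq 'rV[int]_m, uniq r -> \sum_(k <- r) gam k `^ p <= S) ->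
  uniq F -> (forall q, q \in F -> 4^-1 <= \sum_u gam (window q u)) ->
  (size F)%:R <= (8 * 3 ^+ m) `^ p * S * (N.+1%:R ^+ m) `^ (p - 1).
Proof.
move=> p1 g0 hS uF hF.
(* [M] is 8 times the number of points of a window, so the threshold [M^-1] totals 1/8 over a
   window, half of the assumed 1/4. *)
pose M : R := (8 * 3 ^+ m) * N.+1%:R ^+ m.
have X0 : 0 < 8 * 3 ^+ m :> R by rewrite mulr_gt0// exprn_gt0.
have M0 : 0 < M by rewrite mulr_gt0// exprn_gt0.
have cardT8 : #|{: 'rV['I_3]_m * 'rV['I_N.+1]_m}|%:R = M / 8.
  by rewrite card_prod !card_mx !card_ord !mul1n natrM !natrX /M; field.
have lower q : q \in F -> M^-1 `^ (p - 1) * 8^-1 <= \sum_u gam (window q u) `^ p.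
  move=> qF; have := @sum_powR_ge _ (fun u => gam (window q u)) p M^-1 p1.
  rewrite cardT8 (_ : M / 8 / M = 8^-1); last by field; rewrite gt_eqF.
  apply=> //; first by rewrite invr_gt0.
  by apply: le_trans (hF q qF); lra.
have upper : \sum_(q <- F) \sum_u gam (window q u) `^ p <= 3 ^+ m * S.
  under eq_bigr do rewrite -(pair_bigA _ (fun e s => gam (window _ (e, s)) `^ p)) /=.
  rewrite exchange_big/=.
  (* For a fixed relative position [e], different [q] give disjoint cubes, so the points form a list
     without repetition. *)
  have fixe (e : 'rV['I_3]_m) :
      \sum_(q <- F) \sum_s gam (window q (e, s)) `^ p <= S.
    pose r := [seq window q (e, s) | q <- F, s <- index_enum 'rV['I_N.+1]_m].
    have -> : \sum_(q <- F) \sum_s gam (window q (e, s)) `^ p =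
        \sum_(k <- r) gam k `^ p by rewrite big_allpairs_dep.
    apply: hS; apply: allpairs_uniq => //; first exact: index_enum_uniq.
    move=> [q s] [q' s'] _ _ /rowP /= eqw.
    have H i : q 0 i = q' 0 i /\ s 0 i = s' 0 i.
      have := eqw i; rewrite !mxE /= => /divz_rem_inj[+ ->]; split=> //.
      lia.
    by congr (_, _); apply/rowP => i; have [] := H i.
  apply: le_trans (ler_sum _ (fun e _ => fixe e)) _.
  by rewrite sumr_const card_mx card_ord mul1n -(mulr_natl S) natrX.
have : (size F)%:R * (M^-1 `^ (p - 1) * 8^-1) <= 3 ^+ m * S.
  apply: le_trans upper; rewrite mulr_natl -iter_addr_0 -count_predT -big_const_seq.
  rewrite big_seq [leRHS]big_seq.
  by apply: ler_sum => q qF; exact: lower.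
have MM : M `^ (p - 1) * M^-1 `^ (p - 1) = 1.
  by rewrite -powRM ?invr_ge0 ?(ltW M0)// divff ?gt_eqF// powR1.
move=> /(ler_wpM2l (mulr_ge0 (ler0n R 8) (powR_ge0 M (p - 1)))).
have -> : 8 * M `^ (p - 1) * ((size F)%:R * (M^-1 `^ (p - 1) / 8)) =
    (size F)%:R * (M `^ (p - 1) * M^-1 `^ (p - 1)) by field.
rewrite MM mulr1 => /le_trans; apply.
rewrite -(mulr_powRB1 (ltW X0)) ?(lt_le_trans ltr01)//.
by rewrite /M powRM ?exprn_ge0 ?(ltW X0)//; lra.
Qed.

(** The cubes indexed by [Q] are enumerated through the coding of integer vectors by naturals. An
    infinite sum of volumes is the supremum of its finite partial sums, so a bound for finite
    families is enough. *)
Lemma lebesgue_outer_le_count (A : set 'rV[R]_m) (Q : set 'rV[int]_m)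
    (cen : 'rV[int]_m -> 'rV[R]_m) (h X : R) : (0 < m)%N -> 0 <= h ->
  (forall x, A x -> exists2 q, Q q & forall i, `|x 0 i - cen q 0 i| <= h / 2) ->
  (forall F : seq 'rV[int]_m, uniq F -> (forall q, q \in F -> Q q) ->
     (size F)%:R * h ^+ m <= X) ->
  (lebesgue_outer A <= X%:E)%E.
Proof.
move=> m0 h0 hA hX.
have h20 : 0 <= h / 2 by rewrite divr_ge0.
pose e (n : nat) : option 'rV[int]_m :=
  if pickle_inv n is Some q then if `[< Q q >] then Some q else None else None.
pose lo n : 'rV[R]_m := if e n is Some q then \row_i (cen q 0 i - h / 2) else 0.
pose hi n : 'rV[R]_m := if e n is Some q then \row_i (cen q 0 i + h / 2) else 0.
have eQ n q : e n = Some q -> Q q.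
  by rewrite /e; case: pickle_inv => // q'; case: asboolP => // Qq' [<-].
have eK : ocancel e pickle.
  move=> n; rewrite /e; have := @pickle_invK 'rV[int]_m n.
  by case: (pickle_inv n) => //= q; case: ifP.
have vol n : \prod_(i < m) (hi n 0 i - lo n 0 i) = if e n then h ^+ m else 0.
  rewrite /hi /lo; case: (e n) => [q|] /=.
    rewrite -[X in h ^+ X]card_ord -prodr_const; apply: eq_bigr => i _.
    by rewrite !mxE; field.
  (* A natural that codes no element of [Q] gets the box reduced to the origin; its volume vanishes
     because [m] is positive, an empty product being 1. *)
  by rewrite (bigD1 (Ordinal m0))//= !mxE subrr mul0r.
apply: (@le_trans _ _ (esum [set: nat]
    (fun n => (\prod_(i < m) (hi n 0 i - lo n 0 i))%:E))).
  apply: ereal_inf_lbound; exists (lo, hi) => //=; split.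
    move=> n i; rewrite /lo /hi; case: (e n) => [q|]; rewrite !mxE//.
    by rewrite lerD2l ge0_cp.
  move=> x /hA[q Qq hq]; exists (pickle q) => //= i.
  have eq : e (pickle q) = Some q by rewrite /e pickleK_inv asboolT.
  rewrite /lo /hi eq !mxE; have := hq i; rewrite ler_norml; lra.
apply: ge_ereal_sup => _ [B [finB _] <-].
have /finite_seqP[s Bs] := finB.
have -> : B = [set` undup s] by rewrite Bs; apply/seteqP; split => n /=; rewrite mem_undup.
rewrite -fsbig_seq ?undup_uniq// sumEFin lee_fin.
have uF := pmap_uniq eK (undup_uniq s).
have FQ q : q \in pmap e (undup s) -> Q q.
  by rewrite mem_pmap => /mapP[n _ /esym/eQ].
apply: le_trans (hX _ uF FQ).
under eq_bigr do rewrite vol.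
by rewrite -big_mkcond big_const_seq iter_addr_0 size_pmap mulr_natl.
Qed.

End Counting.

(** * Fourier mass near the frequencies [lam grad phi(t)] *)

Section LocalizedSpectrum.
Variables (R : realType) (m : nat) (omega : R -> R) (phi : 'rV[R]_m -> R).
Hypothesis phi_C1 : C1omega_T omega phi.
Hypothesis phi_lip : l1_lipschitz R m phi.

Definition freq_floor (lam : R) (t : 'rV[R]_m) : 'rV[int]_m :=
  \row_i Num.floor (lam * 'D_(evec R i) phi t).

Definition freq_cube (N : nat) (lam : R) (t : 'rV[R]_m) : 'rV[int]_m :=
  \row_i (freq_floor lam t 0%R i %/ N.+1%:Z)%Z.

Lemma freq_cubeP N lam t i :
  N.+1%:Z * freq_cube N lam t 0 i <= freq_floor lam t 0 i /\
  freq_floor lam t 0 i < N.+1%:Z * (freq_cube N lam t 0 i + 1).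
Proof.
rewrite /freq_cube mxE; move: (freq_floor lam t 0 i) => k.
have L0 : N.+1%:Z != 0 by [].
have dv := divz_eq k N.+1%:Z.
have r0 := modz_ge0 k L0; have r1 := ltz_pmod k (ltn0Sn N : (0 < N.+1%:Z)).
by rewrite mulrDr mulr1 mulrC; split; lia.
Qed.

(** The kernel estimate is applied with [k0] the integer part of [lam grad phi(t)] and penalty
    [2 / (1 - cos rho)]. The last hypothesis makes [N] large enough for the kernel to lose at most
    1/4 of the initial 1/2. *)
Lemma window_fourier_ge (N : nat) (lam rho E : R) (t : 'rV[R]_m) :
  0 < rho -> rho <= 1 ->
  (forall (j : 'I_m) (z : 'rV[R]_m), (forall i, `|z 0 i - t 0 i| <= rho) ->
     `|'D_(evec R j) phi z - 'D_(evec R j) phi t| <= E) ->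
  m%:R * ((`|lam| * E + 1) * rho) <= 1 ->
  512 * m%:R <= (rho * N.+1%:R) ^+ 2 ->
  4^-1 <= \sum_u fourier_abs (expi_re lam phi) (expi_im lam phi)
                  (window m N (freq_cube N lam t) u).
Proof.
move=> rho0 rho1 hE hle hN.
set gam := fourier_abs _ _; set q := freq_cube N lam t; set k0 := freq_floor lam t.
set G := \sum_u _.
have g0 k : 0 <= gam k by exact: sqrtr_ge0.
have hk i : `|lam * 'D_(evec R i) phi t - (k0 0 i)%:~R| <= 1.
  rewrite mxE; set x := lam * _.
  have h1 : (Num.floor x)%:~R <= x by exact: floor_le.
  have h2 : x < (Num.floor x + 1)%:~R by exact: floorD1_gt.
  by rewrite ger0_norm ?subr_ge0// lerBlDl -intrD1 ltW.
have hcos := @cos_phase_lower_bound R m omega phi phi_C1 k0 lam rho E t rho0 rho1 hk hE hle.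
have zvE (J : 'rV['I_N.+1]_m) i : exists2 k : nat, intv m N J 0 i = k%:Z & (k <= N)%N.
  by exists (J 0 i : nat); rewrite ?mxE// -ltnS ltn_ord.
(* A difference of two points of [{0, ..., N}] is less than [N + 1] in absolute value, so it moves
   [k0] to an adjacent cube at most. *)
have rng (J J' : 'rV['I_N.+1]_m) i :
    N.+1%:Z * (q 0 i - 1) <= (k0 + intv m N J - intv m N J') 0 i /\
    (k0 + intv m N J - intv m N J') 0 i < N.+1%:Z * (q 0 i + 2).
  have [h1 h2] := freq_cubeP N lam t i.
  rewrite -/q -/k0 in h1 h2.
  have -> : (k0 + intv m N J - intv m N J') 0 i =
      k0 0 i + intv m N J 0 i - intv m N J' 0 i.
    by rewrite [LHS]mxE [X in X + _]mxE [X in _ + X]mxE.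
  have [a -> ha] := zvE J i; have [b -> hb] := zvE J' i.
  move: h1 h2; rewrite !mulrDr; move: (N.+1%:Z * q 0 i) (k0 0 i) => x y; lia.
have hG1 (J : 'rV['I_N.+1]_m) :
    \sum_(J' : 'rV['I_N.+1]_m) gam (k0 + intv m N J - intv m N J') <= G.
  apply: (@window_sum_ge R m N gam _ (fun J' => k0 + intv m N J - intv m N J') q) => //.
  by move=> J1 J2 /addrI/oppr_inj/intv_inj.
have hG2 (J : 'rV['I_N.+1]_m) :
    \sum_(J' : 'rV['I_N.+1]_m) gam (k0 + intv m N J' - intv m N J) <= G.
  apply: (@window_sum_ge R m N gam _ (fun J' => k0 + intv m N J' - intv m N J) q) => //.
  by move=> J1 J2 /addIr/addrI/intv_inj.
have := fourier_window_lower_bound R m N t phi lam phi_lip k0 _ _ G hcos hG1 hG2.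
apply: le_trans.
have L0 : 0 < N.+1%:R :> R by rewrite ltr0n.
(* From [pi < 4] the angle is at most [4 / (N + 1)], and [1 - cos] is at most half its square. *)
have ck : 1 - cos (kangle R N) <= 8 / N.+1%:R ^+ 2.
  have k0' : 0 <= kangle R N by rewrite divr_ge0// pi_ge0.
  have k4 : kangle R N <= 4 / N.+1%:R.
    rewrite /kangle ler_pM ?pi_ge0 ?invr_ge0//; last first.
      by rewrite lef_pV2 ?posrE// ler_nat.
    by have := pihalf_lt2 R; lra.
  have : kangle R N ^+ 2 <= (4 / N.+1%:R) ^+ 2 by rewrite lerXn2r// nnegrE divr_ge0.
  rewrite (_ : (4 / N.+1%:R) ^+ 2 = 2 * (8 / N.+1%:R ^+ 2)); last by field; rewrite gt_eqF.
  have := cos_ge_quadratic _ (kangle R N).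
  by move: (cos _) (kangle R N ^+ 2) (8 / _) => c k2 y; lra.
have cr := one_sub_cos_ge _ _ (ltW rho0) rho1.
have rho8 : 0 < rho ^+ 2 / 8 by rewrite divr_gt0// exprn_gt0.
have c0 : 0 < 1 - cos rho by exact: lt_le_trans cr.
suff : 2 * (m%:R * (1 - cos (kangle R N))) <= 4^-1 * (1 - cos rho).
  rewrite -ler_pdivrMr//; lra.
apply: (@le_trans _ _ (2 * (m%:R * (8 / N.+1%:R ^+ 2)))).
  by rewrite ler_wpM2l// ler_wpM2l.
(* It remains to compare [16 m / (N + 1)^2] with [rho^2 / 32], whence the constant 512. *)
apply: (@le_trans _ _ (4^-1 * (rho ^+ 2 / 8))); last by rewrite ler_wpM2l.
rewrite (_ : 2 * _ = 16 * m%:R / N.+1%:R ^+ 2); last by ring.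
rewrite ler_pdivrMr ?exprn_gt0//; rewrite exprMn in hN; lra.
Qed.

End LocalizedSpectrum.

(** Dividing by [lam] turns the frequency cubes into cubes of side [(N + 1) / |lam|] that cover the
    range of the gradient. *)
Lemma range_grad_outer_le (R : realType) (m N : nat) (phi : 'rV[R]_m -> R) (lam X : R) :
  (0 < m)%N -> lam != 0 ->
  (forall F : seq 'rV[int]_m, uniq F ->
     (forall q, q \in F -> exists t, q = freq_cube R m phi N lam t) ->
     (size F)%:R * (N.+1%:R / `|lam|) ^+ m <= X) ->
  (lebesgue_outer (range (grad phi)) <= X%:E)%E.
Proof.
move=> m0 l0 hX.
apply: (@lebesgue_outer_le_count R m _ [set q | exists t, q = freq_cube R m phi N lam t]
  (fun q => \row_i ((N.+1%:R * (q 0 i)%:~R + N.+1%:R / 2) / lam)) (N.+1%:R / `|lam|)) => //.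
move=> _ [t _ <-]; exists (freq_cube R m phi N lam t); first by exists t.
move=> i; have [h1 h2] := freq_cubeP R m phi N lam t i.
rewrite [X in `|X - _|]mxE [X in _ - X]mxE.
move: (freq_cube _ _ _ _ _ _ _ _) h1 h2 => q; rewrite mxE.
set d := 'D__ _ _ => h1 h2.
have f1 : (Num.floor (lam * d))%:~R <= lam * d by exact: floor_le.
have f2 : lam * d < (Num.floor (lam * d) + 1)%:~R by exact: floorD1_gt.
have g1 : (N.+1%:R * q%:~R : R) <= lam * d.
  by apply: le_trans f1; rewrite -[N.+1%:R]/(N.+1%:Z%:~R) -intrM ler_int.
have g2 : lam * d <= (N.+1%:R * q%:~R + N.+1%:R : R).
  (* The floor is an integer below [(N + 1) * (q + 1)], so its successor still does not exceed that
     number. *)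
  apply: le_trans (ltW f2) _.
  by rewrite -[N.+1%:R]/(N.+1%:Z%:~R) -intrM -intrD ler_int; lia.
rewrite (_ : d - _ = (lam * d - (N.+1%:R * q%:~R + N.+1%:R / 2)) / lam); last by field.
rewrite normrM normfV [leRHS]mulrAC ler_wpM2r ?invr_ge0//.
rewrite ler_norml; lra.
Qed.

(** * Choice of the scales and the lower bound for the norm *)

Theorem theorem1 (R : realType) (m : nat) (p : R) (omega chiinv : R -> R)
  (phi : 'rV[R]_m -> R) :
  (1 <= m)%N -> 1 <= p -> p < 2 ->
  {within `[0, +oo[, continuous omega} ->
  (forall x y : R, 0 <= x -> x <= y -> omega x <= omega y) ->
  omega 0 = 0 ->
  (forall y : R, 0 < y -> 0 <= chiinv y /\ chiinv y * omega (chiinv y) = y) ->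
  C1omega_T omega phi ->
  (0 < lebesgue_outer (range (grad phi)))%E ->
  exists c : R, 0 < c /\
    forall lam : R, Lambda phi p lam -> 1 <= `|lam| ->
      c * (`|lam| `^ p^-1 * chiinv `|lam|^-1) ^+ m
        <= Ap_norm p (expi_re lam phi) (expi_im lam phi).
Proof.
move=> m1 p1 _ _ om_mono om0 hchi phi_C1 outer_gt0.
have p0 : 0 < p by exact: lt_le_trans ltr01 p1.
have om_ge0 x : 0 <= x -> 0 <= omega x by move=> x0; rewrite -om0 om_mono.
have [C [d0 [C0 d00 hC]]] := uniform_modulus _ _ _ _ phi_C1.
have [B hB] : exists B : R, forall j x, `|'D_(evec R j) phi x| <= B.
  by apply: (derive_bounded _ _ _ _ phi_C1 C d0 d00 (om_ge0 _ (ltW d00))) => j x y;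
    apply: hC => //; exact: om_ge0 (ltW d00).
have phi_lip := l1_lipschitz_of_derive _ _ _ _ phi_C1 B hB.
have chi_gt0 y : 0 < y -> 0 < chiinv y.
  move=> y0; have [h1 h2] := hchi y y0; rewrite lt_neqAle h1 andbT.
  by apply/eqP => h; move: h2; rewrite -h mul0r => h2; rewrite -h2 ltxx in y0.
pose b := chiinv 1.
have b0 : 0 < b by exact: chi_gt0.
(* If [chiinv y] exceeded [b], then [y], its image under [chi], would exceed [chi b = 1], since
   [omega b] is positive and [omega] is nondecreasing. *)
have chi_le y : 0 < y -> y <= 1 -> chiinv y <= b.
  move=> y0 y1; rewrite leNgt; apply/negP => by_.
  have [_ e1] := hchi 1 ltr01; have [_ ey] := hchi y y0; rewrite -/b in e1.
  have omb : 0 < omega b by rewrite -(pmulr_rgt0 _ b0) e1.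
  have : 1 < y; last by rewrite ltNge y1.
  rewrite -e1 -ey; apply: lt_le_trans (_ : chiinv y * omega b <= _).
    by rewrite ltr_pM2r.
  by rewrite ler_pM2l ?chi_gt0// om_mono// ltW.
(* A finite positive lower bound for the outer measure; if that measure is infinite, 1 will do. *)
have [mu [mu0 hmu]] : exists mu : R, 0 < mu /\
    (mu%:E <= lebesgue_outer (range (grad phi)))%E.
  case: (lebesgue_outer _) outer_gt0 => [r||]//=.
    by rewrite lte_fin => r0; exists r.
  by move=> _; exists 1; rewrite leey.
(* The denominator dominates 1, [b], [b / d0] and [C + b]; these give [eps <= 1], [rho <= 1],
   [eps * dl <= d0] and a phase error of at most 1. *)
pose eps := (1 + b + b / d0 + C)^-1.
have bd0 : 0 < b / d0 by rewrite divr_gt0.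
have den0 : 0 < 1 + b + b / d0 + C by lra.
have eps0 : 0 < eps by rewrite invr_gt0.
have epsP z : z <= 1 + b + b / d0 + C -> eps * z <= 1.
  by move=> hz; rewrite mulrC ler_pdivrMr// mul1r.
have eps1 : eps <= 1 by rewrite -[eps]mulr1 epsP//; lra.
have mR0 : 0 < m%:R :> R by rewrite ltr0n.
have mR1 : 1 <= m%:R :> R by rewrite ler1n.
pose kap : R := 24 * m%:R ^+ 2 / eps.
have kap0 : 0 < kap by rewrite divr_gt0// mulr_gt0// exprn_gt0.
pose C1 : R := (8 * 3 ^+ m) `^ p.
have C10 : 0 < C1 by rewrite powR_gt0// mulr_gt0// exprn_gt0.
exists ((mu / C1) `^ p^-1 / kap ^+ m); split.
  by rewrite divr_gt0 ?powR_gt0 ?exprn_gt0// divr_gt0.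
move=> lam [_ hfin] lam1.
have lam0 : 0 < `|lam| by exact: lt_le_trans ltr01 lam1.
set dl := chiinv `|lam|^-1.
have ilam0 : 0 < `|lam|^-1 by rewrite invr_gt0.
have dl0 : 0 < dl by exact: chi_gt0.
have dlb : dl <= b by apply: chi_le => //; rewrite invf_le1.
have omdl : omega dl = (`|lam| * dl)^-1.
  have [_ e] := hchi _ ilam0; rewrite -/dl in e.
  by rewrite invfM -e mulrC mulKf ?gt_eqF.
pose rho := eps * dl / m%:R.
have ed0 : 0 < eps * dl by rewrite mulr_gt0.
have rho0 : 0 < rho by rewrite divr_gt0.
have edd0 : eps * dl <= d0.
  rewrite -[leRHS]mul1r -ler_pdivrMr// -mulrA epsP//.
  have : dl / d0 <= b / d0 by rewrite ler_pM2r// invr_gt0.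
  lra.
have rho1 : rho <= 1.
  by rewrite /rho ler_pdivrMr// mul1r (le_trans _ mR1)// epsP//; lra.
(* The factor 23 is chosen because its square 529 exceeds 512; rounding costs at most [m / rho],
   which accounts for the 24 in [kap]. *)
pose N := Num.truncn (23 * m%:R / rho).
have hN1 : 23 * m%:R < rho * N.+1%:R.
  by rewrite (mulrC rho) -ltr_pdivrMr// truncnS_gt.
have hN2 : N.+1%:R <= kap / dl.
  have x0 : 0 <= 23 * m%:R / rho by apply: divr_ge0; [exact: mulr_ge0|exact: ltW].
  have hN : N%:R <= 23 * m%:R / rho by rewrite truncn_le.
  have e : 24 * m%:R / rho = kap / dl by rewrite /rho /kap; field; rewrite !gt_eqF.
  rewrite -e -natr1.
  have : 1 <= m%:R / rho by rewrite ler_pdivlMr// mul1r (le_trans rho1).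
  lra.
have mrho : m%:R * rho = eps * dl by rewrite /rho mulrC divfK ?gt_eqF.
pose E := C * omega (eps * dl).
have hE (t : 'rV[R]_m) (j : 'I_m) (z : 'rV[R]_m) : (forall i, `|z 0 i - t 0 i| <= rho) ->
    `|'D_(evec R j) phi z - 'D_(evec R j) phi t| <= E.
  move=> hz; apply: hC => //; first by apply: om_ge0; exact: ltW.
  by rewrite -mrho (le_trans (edist_le_sum _ _ _ _))//; exact: sum_ord_le.
have hle : m%:R * ((`|lam| * E + 1) * rho) <= 1.
  rewrite mulrCA mrho.
  (* Monotonicity replaces [omega (eps * dl)] by [omega dl = 1 / (|lam| * dl)], so [|lam|] and [dl]
     cancel and the error is at most [eps * (C + b)]. *)
  have omle : omega (eps * dl) <= omega dl.
    by rewrite om_mono ?(ltW ed0)// ler_piMl// ltW.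
  have : `|lam| * E * (eps * dl) <= eps * C.
    rewrite /E; apply: (@le_trans _ _ (`|lam| * (C * omega dl) * (eps * dl))).
      by rewrite ler_pM2r// ler_pM2l// ler_wpM2l.
    rewrite omdl le_eqVlt; apply/orP; left; apply/eqP; field.
    by rewrite !gt_eqF.
  have : eps * (C + b) <= 1 by rewrite epsP//; lra.
  have : eps * dl <= eps * b by rewrite ler_pM2l.
  lra.
have hN512 : 512 * m%:R <= (rho * N.+1%:R) ^+ 2.
  apply: (@le_trans _ _ ((23 * m%:R) ^+ 2)); last first.
    by rewrite lerXn2r ?nnegrE ?(ltW hN1)// mulr_ge0// ltW.
  have : m%:R <= m%:R ^+ 2 :> R by rewrite expr2 ler_peMr// ltW.
  rewrite exprMn; lra.
have hwin t := window_fourier_ge R m omega phi phi_C1 phi_lip N lam rho E t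
  rho0 rho1 (hE t) hle hN512.
set gam := fourier_abs (expi_re lam phi) (expi_im lam phi) in hwin.
pose S := fine (Ap_sum p (expi_re lam phi) (expi_im lam phi)).
(* Membership in [Lambda] makes the sum finite, so [fine] returns its true value and not the default
   0. *)
have SE : Ap_sum p (expi_re lam phi) (expi_im lam phi) = S%:E.
  rewrite /S fineK// ge0_fin_numE//.
  by apply: esum_ge0 => k _; rewrite lee_fin powR_ge0.
have hS (r : seq 'rV[int]_m) : uniq r -> \sum_(k <- r) gam k `^ p <= S.
  by move=> ur; rewrite -lee_fin -SE; exact: sum_le_esum.
have S0 : 0 <= S by have := hS [::] isT; rewrite big_nil.
have lamN0 : lam != 0 by rewrite -normr_gt0.
have L0 : 0 < N.+1%:R ^+ m :> R by rewrite exprn_gt0.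
have hout : mu <= C1 * S * (N.+1%:R ^+ m) `^ (p - 1) * (N.+1%:R / `|lam|) ^+ m.
  rewrite -lee_fin; apply: le_trans hmu _.
  apply: (range_grad_outer_le R m N phi lam) => // F uF hF.
  rewrite ler_wpM2r ?exprn_ge0 ?divr_ge0//.
  apply: (count_windows R m N gam p S F p1) => //.
  - by move=> k; exact: sqrtr_ge0.
  - by move=> q /hF[t ->]; exact: hwin.
(* The exponent [p - 1] from the counting and the volume of one cube combine into [(N + 1)^(mp)],
   and [N + 1] is at most [kap / dl]. *)
have key : mu * `|lam| ^+ m <= C1 * S * (kap ^+ m / dl ^+ m) `^ p.
  apply: (@le_trans _ _ (C1 * S * (N.+1%:R ^+ m) `^ p)); last first.
    rewrite ler_wpM2l ?mulr_ge0 ?(ltW C10)// ge0_ler_powR ?(ltW p0) ?nnegrE ?(ltW L0)//.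
      by rewrite divr_ge0// exprn_ge0 ?(ltW kap0) ?(ltW dl0).
    rewrite -expr_div_n lerXn2r// nnegrE; first exact: ler0n.
    by apply: divr_ge0; exact: ltW.
  rewrite -(@mulr_powRB1 _ (N.+1%:R ^+ m) p) ?(ltW L0)//.
  rewrite -ler_pdivlMr ?exprn_gt0//; apply: le_trans hout _.
  by rewrite expr_div_n le_eqVlt; apply/orP; left; apply/eqP; ring.
have kd0 : 0 < kap ^+ m / dl ^+ m by rewrite divr_gt0// exprn_gt0.
have key2 : mu / C1 * `|lam| ^+ m <= S * (kap ^+ m / dl ^+ m) `^ p.
  by rewrite mulrAC ler_pdivrMr// [leRHS]mulrC mulrA.
have ip0 : 0 <= p^-1 by rewrite invr_ge0 ltW.
have : (mu / C1 * `|lam| ^+ m) `^ p^-1 <= (S * (kap ^+ m / dl ^+ m) `^ p) `^ p^-1.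
  by rewrite ge0_ler_powR// nnegrE mulr_ge0 ?powR_ge0 ?divr_ge0 ?exprn_ge0 ?(ltW mu0) ?(ltW C10).
have muC0 : 0 <= mu / C1 by apply: divr_ge0; exact: ltW.
rewrite (powRM _ muC0) ?exprn_ge0// (powRM _ S0) ?powR_ge0//.
rewrite -powRrM divff ?gt_eqF// powRr1 ?(ltW kd0)//.
rewrite -(@powR_mulrn _ `|lam| m)// powRAC powR_mulrn ?powR_ge0// => h.
rewrite /Ap_norm -/S (exprMn m _ dl).
rewrite (_ : _ * _ = (mu / C1) `^ p^-1 * (`|lam| `^ p^-1) ^+ m / (kap ^+ m / dl ^+ m)).
  by rewrite ler_pdivrMr.
by field; rewrite !expf_neq0 ?gt_eqF.
Qed.
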